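(* Let $R$ be a commutative noetherian local ring with residue field $k$. Let $M$ be a finitely generated $R$-module and $n>0$ an integer. Let $x$ be an element of $R$ which is regular on both $R$ and $M$. Then the following inequalities hold: $$\xi_{R/xR}(n-1,M/xM)\le\xi_R(n,M)\le\xi_{R/xR}(n,M/xM).$$
   Context: An element regular on $R$ and $M$ means an element of the maximal ideal of $R$ that is a nonzerodivisor on both $R$ and $M$. For a commutative noetherian local ring $S$ with residue field $k$, $\underline{\operatorname{Hom}}_S(X,Y)$ is the quotient of $\operatorname{Hom}_S(X,Y)$ by the submodule of homomorphisms factoring through a projective module. The syzygy $\Omega_SN$ of a finitely generated $S$-module $N$ is the kernel of a surjection from a finitely generated projective module onto $N$; it is unique up to projective summands and defines a functor $\Omega_S$ on the stable category $\underline{\operatorname{mod}}S$ (finitely generated $S$-modules with morphisms $\underline{\operatorname{Hom}}_S$); $\Omega_S^n$ is its $n$-fold iterate. The $n$-th approximated $\xi$-invariant $\xi_S(n,N)$ is the $k$-dimension of the kernel of the composite $\operatorname{Hom}_S(N,k)\to\underline{\operatorname{Hom}}_S(N,k)\xrightarrow{\Omega_S^n}\underline{\operatorname{Hom}}_S(\Omega_S^nN,\Omega_S^nk)$, where the first map is the canonical surjection. *)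

(* Defs.v *)
From HB Require Import structures.
Set Warnings "-notation-overridden,-ambiguous-paths,-redundant-canonical-projection,-projection-no-head-constant".
From mathcomp Require Import all_boot all_order all_algebra.
From mathcomp Require Import boolp.

Set Implicit Arguments.
Unset Strict Implicit.
Unset Printing Implicit Defensive.

Import GRing.Theory.
Local Open Scope ring_scope.
Local Open Scope quotient_scope.

(* Subsets of a ring or module are boolean predicates; by classical logic    *)
(* ([< P >], from boolp) every subset is of this form.                        *)

Definition fin_gen (R : nzRingType) (V : lmodType R) (W : {pred V}) : Prop :=
  exists (n : nat) (g : 'I_n -> V), (forall i, g i \in W) /\
    forall v, v \in W -> exists c : 'I_n -> R, v = \sum_(i < n) c i *: g i.

(* The ideals of R are the submodules of R^o.                                 *)
Definition noetherian (R : nzRingType) : Prop :=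
  forall I : {pred R^o}, submod_closed I -> fin_gen I.

(* [idealr_closed] only holds of proper ideals.                               *)
Definition maximal_ideal (R : comNzRingType) (I : {pred R}) : Prop :=
  idealr_closed I /\
  forall J : {pred R}, idealr_closed J -> {subset I <= J} -> {subset J <= I}.

HB.mixin Record isNoethLocal R of GRing.ComNzRing R := {
  max_ideal : {pred R};
  max_ideal_maximal : maximal_ideal max_ideal;
  max_ideal_unique : forall J : {pred R}, maximal_ideal J -> J =i max_ideal;
  noetherianP : noetherian R
}.
#[short(type="noethLocalType")]
HB.structure Definition NoethLocal := {R of isNoethLocal R & GRing.ComNzRing R}.
Arguments max_ideal s : clear implicits.
Arguments noetherianP s : clear implicits.

HB.mixin Record isFinGen (R : nzRingType) V of GRing.Lmodule R V := {
  fin_gen_predT : fin_gen (predT : {pred V})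
}.
#[short(type="fgModType")]
HB.structure Definition FinGenModule (R : nzRingType) :=
  {V of isFinGen R V & GRing.Lmodule R V}.

Definition submod_pred (R : pzRingType) (V : lmodType R) (I : {pred V})
  of submod_closed I : {pred V} := I.
HB.instance Definition _ (R : pzRingType) (V : lmodType R) (I : {pred V})
    (I_closed : submod_closed I) :=
  GRing.isZmodClosed.Build V (submod_pred I_closed)
    (I_closed : zmod_closed I).

Section QuotientModule.
Variables (R : pzRingType) (V : lmodType R) (I : {pred V}).
Hypothesis I_closed : submod_closed I.
Local Notation Q := (Quotient.quot (submod_pred I_closed)).

Definition mod_quot : Type := Q.
HB.instance Definition _ := GRing.Zmodule.on mod_quot.

Definition mod_proj (v : V) : mod_quot :=
  \pi_Q v.
Definition mod_repr (q : mod_quot) : V :=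
  repr (q : Q).

Lemma mod_reprK q : mod_proj (mod_repr q) = q.
Proof. exact: reprK. Qed.
Lemma mod_projP u v : mod_proj u = mod_proj v <-> u - v \in I.
Proof.
have E : (u - v \in I) = (mod_proj u == mod_proj v).
  exact: (Quotient.idealrBE (submod_pred I_closed)).
by rewrite E; split=> /eqP.
Qed.
Lemma mod_projD : {morph mod_proj : u v / u + v}.
Proof. exact: Quotient.pi_add. Qed.
Lemma mod_proj0 : mod_proj 0 = 0.
Proof. exact: raddf0 (\pi_Q). Qed.

Definition quot_scale (a : R) (q : mod_quot) : mod_quot :=
  mod_proj (a *: mod_repr q).

Fact quot_scale_proj a v : quot_scale a (mod_proj v) = mod_proj (a *: v).
Proof.
apply/mod_projP; rewrite -scalerBr -[_ *: _]addr0.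
by apply: I_closed.2; [apply/mod_projP; rewrite mod_reprK | exact: I_closed.1].
Qed.
Fact quot_scaleA a b q : quot_scale a (quot_scale b q) = quot_scale (a * b) q.
Proof. by rewrite -[q]mod_reprK !quot_scale_proj scalerA. Qed.
Fact quot_scale1 : left_id 1 quot_scale.
Proof. by move=> q; rewrite -[q]mod_reprK quot_scale_proj scale1r. Qed.
Fact quot_scaleDr : right_distributive quot_scale +%R.
Proof.
move=> a p q; rewrite -[p]mod_reprK -[q]mod_reprK.
by rewrite -mod_projD !quot_scale_proj scalerDr mod_projD.
Qed.
Fact quot_scaleDl q : {morph quot_scale^~ q : a b / a + b}.
Proof.
by move=> a b; rewrite -[q]mod_reprK !quot_scale_proj scalerDl mod_projD.
Qed.
HB.instance Definition _ := GRing.Zmodule_isLmodule.Build R mod_quot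
  quot_scaleA quot_scale1 quot_scaleDr quot_scaleDl.

Fact mod_proj_linear : linear mod_proj.
Proof. by move=> a u v; rewrite mod_projD -quot_scale_proj. Qed.
HB.instance Definition _ :=
  GRing.isLinear.Build R V mod_quot _ mod_proj mod_proj_linear.
End QuotientModule.

Section Hom.
Variables (R : comNzRingType) (X Y : lmodType R).
Implicit Types f g h : {linear X -> Y}.

Lemma linear_ext f g : f =1 g -> f = g.
Proof.
case: f g => [f [Fa Fs]] [g [Ga Gs]] /= /funext e.
case: _ / e Ga Gs => Ga Gs; case: Fa Fs Ga Gs => [Fa] [Fs] [Ga] [Gs].
by rewrite (Prop_irrelevance Fa Ga) (Prop_irrelevance Fs Gs).
Qed.

Definition hom_zero : {linear X -> Y} := \0.
Definition hom_opp f : {linear X -> Y} := \- f.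
Definition hom_add f g : {linear X -> Y} := f \+ g.
Definition hom_scale (a : R) f : {linear X -> Y} := a \*: f.

Fact hom_addA : associative hom_add.
Proof. by move=> f g h; apply: linear_ext => x /=; rewrite addrA. Qed.
Fact hom_addC : commutative hom_add.
Proof. by move=> f g; apply: linear_ext => x /=; rewrite addrC. Qed.
Fact hom_add0 : left_id hom_zero hom_add.
Proof. by move=> f; apply: linear_ext => x /=; rewrite add0r. Qed.
Fact hom_addN : left_inverse hom_zero hom_opp hom_add.
Proof. by move=> f; apply: linear_ext => x /=; rewrite addNr. Qed.
Fact hom_scaleA a b f : hom_scale a (hom_scale b f) = hom_scale (a * b) f.
Proof. by apply: linear_ext => x /=; rewrite scalerA. Qed.
Fact hom_scale1 : left_id 1 hom_scale.
Proof. by move=> f; apply: linear_ext => x /=; rewrite scale1r. Qed.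
Fact hom_scaleDr : right_distributive hom_scale hom_add.
Proof. by move=> a f g; apply: linear_ext => x /=; rewrite scalerDr. Qed.
Fact hom_scaleDl f : {morph hom_scale^~ f : a b / a + b >-> hom_add a b}.
Proof. by move=> a b; apply: linear_ext => x /=; rewrite scalerDl. Qed.

HB.instance Definition _ := gen_eqMixin {linear X -> Y}.
HB.instance Definition _ := gen_choiceMixin {linear X -> Y}.
HB.instance Definition _ := GRing.isZmodule.Build {linear X -> Y}
  hom_addA hom_addC hom_add0 hom_addN.
HB.instance Definition _ := GRing.Zmodule_isLmodule.Build R {linear X -> Y}
  hom_scaleA hom_scale1 hom_scaleDr hom_scaleDl.
End Hom.

Definition projective (R : comNzRingType) (P : lmodType R) : Prop :=
  forall (X Y : lmodType R) (p : {linear X -> Y}) (f : {linear P -> Y}),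
    (forall y, exists x, p x = y) ->
    exists g : {linear P -> X}, forall v, p (g v) = f v.

Lemma projective_prod (R : comNzRingType) (P Q : lmodType R) :
  projective P -> projective Q -> projective (P * Q)%type.
Proof.
move=> projP projQ X Y p f p_surj.
pose inP : P -> (P * Q)%type := fun u => (u, 0).
pose inQ : Q -> (P * Q)%type := fun v => (0, v).
have inP_lin : linear inP.
  by move=> a u v; rewrite /inP; congr pair; rewrite /= scaler0 addr0.
have inQ_lin : linear inQ.
  by move=> a u v; rewrite /inQ; congr pair; rewrite /= scaler0 addr0.
pose iP := HB.pack_for {linear P -> (P * Q)%type} inP
  (GRing.isLinear.Build _ _ _ _ inP inP_lin).
pose iQ := HB.pack_for {linear Q -> (P * Q)%type} inQ
  (GRing.isLinear.Build _ _ _ _ inQ inQ_lin).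
have [gP gPE] := projP X Y p (f \o iP) p_surj.
have [gQ gQE] := projQ X Y p (f \o iQ) p_surj.
exists ((gP \o fst) \+ (gQ \o snd)) => -[u v] /=.
transitivity (p (gP u) + p (gQ v)); first exact: raddfD.
rewrite gPE gQE; transitivity (f (inP u + inQ v)).
  by symmetry; exact: raddfD.
by congr (f _); congr pair; rewrite /= ?addr0 ?add0r.
Qed.

Section StableHom.
Variables (R : comNzRingType) (X Y : lmodType R).

Definition thru_projective : {pred {linear X -> Y}} := fun f =>
  `[< exists (P : lmodType R) (a : {linear X -> P}) (b : {linear P -> Y}),
        projective P /\ f =1 b \o a >].

Fact thru_projective_closed : submod_closed thru_projective.
Proof.
split.
  apply/asboolP; exists 'rV[R]_0, \0, \0; split=> // U V p f p_surj.
  by exists \0 => v /=; rewrite raddf0 (_ : v = 0) ?raddf0 // [v]thinmx0.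
move=> c f g /asboolP [P [a [b [projP fE]]]] /asboolP [Q [a' [b' [projQ gE]]]].
apply/asboolP; exists (P * Q)%type.
pose h : X -> (P * Q)%type := fun x => (c *: a x, a' x).
have h_lin : linear h.
  move=> d x y; rewrite /h; congr pair; last exact: linearP.
  by rewrite /= (linearP a) scalerDr !scalerA [d * c]mulrC.
exists (HB.pack_for {linear X -> (P * Q)%type} h
  (GRing.isLinear.Build _ _ _ _ h h_lin)).
exists ((b \o fst) \+ (b' \o snd)); split; first exact: projective_prod.
by move=> x /=; rewrite fE gE /= linearZ.
Qed.

Definition stable_hom : lmodType R := mod_quot thru_projective_closed.
Definition to_stable : {linear {linear X -> Y} -> stable_hom} :=
  mod_proj thru_projective_closed.
End StableHom.
Arguments to_stable {R X Y}.

Lemma submod_closed_sum (R : nzRingType) (V : lmodType R) (W : {pred V})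
    (n : nat) (c : 'I_n -> R) (g : 'I_n -> V) :
  submod_closed W -> (forall i, g i \in W) -> \sum_(i < n) c i *: g i \in W.
Proof.
move=> [W0 WD] gW; elim: n c g gW => [|n IHn] c g gW; first by rewrite big_ord0.
by rewrite big_ord_recl WD //; apply: IHn.
Qed.

Lemma fin_gen_sub (R : comNzRingType) (V : lmodType R) (W : {pred V}) :
  noetherian R -> fin_gen (predT : {pred V}) -> submod_closed W -> fin_gen W.
Proof.
move=> noethR [n [g [_ gV]]]; have {}gV v := gV v isT.
have : forall v, v \in W -> exists c : 'I_n -> R, v = \sum_(i < n) c i *: g i.
  by move=> v _; exact: gV.
elim: n g W {gV} => [|n IHn] g W gW Wsub.
  exists 0%N, g; split=> [[]//|v /gW [c ->]].
  by exists c.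
pose T : {pred V} := fun v =>
  `[< exists c : 'I_n -> R, v = \sum_(i < n) c i *: g (lift ord0 i) >].
have Tsub : submod_closed T.
  split; first by apply/asboolP; exists (fun=> 0); rewrite big1 // => i _;
    rewrite scale0r.
  move=> a u v /asboolP [c ->] /asboolP [d ->].
  apply/asboolP; exists (fun i => a * c i + d i).
  rewrite scaler_sumr -big_split /=; apply: eq_bigr => i _.
  by rewrite scalerDl scalerA.
pose W' : {pred V} := fun v => (v \in W) && (v \in T).
have W'sub : submod_closed W'.
  split; first by apply/andP; split; [exact: Wsub.1 | exact: Tsub.1].
  move=> a u v /andP [uW uT] /andP [vW vT].
  by apply/andP; split; [exact: Wsub.2 | exact: Tsub.2].
have [|m [h [hW' hgen]]] := IHn (fun i => g (lift ord0 i)) W' _ W'sub.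
  by move=> v /andP [_ /asboolP].
pose I : {pred R^o} := fun a =>
  `[< exists2 v, v \in W & v - (a : R) *: g ord0 \in T >].
have Isub : submod_closed I.
  split; first by apply/asboolP; exists 0; [exact: Wsub.1 |
    rewrite scale0r subr0; exact: Tsub.1].
  move=> a b c /asboolP [u uW uT] /asboolP [v vW vT].
  apply/asboolP; exists (a *: u + v); first exact: Wsub.2.
  rewrite (_ : _ - _ = a *: (u - (b : R) *: g ord0) + (v - (c : R) *: g ord0)).
    exact: Tsub.2.
  by rewrite scalerBr scalerA scalerDl opprD addrACA.
have [r [k [kI kgen]]] := noethR I Isub.
have wex j : exists v, v \in W /\ v - (k j : R) *: g ord0 \in T.
  by have /asboolP [v vW vT] := kI j; exists v.
have [w wP] := boolp.choice wex.
exists (m + r)%N, (fun i => match split i with inl a => h a | inr b => w b end).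
split=> [i|v vW].
  by case: (split i) => j; [have /andP[] := hW' j | have [] := wP j].
have [c vE] := gW v vW; rewrite big_ord_recl in vE.
have /kgen [d dE] : (c ord0 : R^o) \in I.
  apply/asboolP; exists v => //; rewrite vE addrAC subrr add0r.
  by apply/asboolP; exists (fun i => c (lift ord0 i)).
pose u := v - \sum_(j < r) d j *: w j.
have /hgen [e eE] : u \in W'.
  apply/andP; split.
    rewrite /u addrC -scaleN1r; apply: Wsub.2 => //.
    by apply: submod_closed_sum => // j; have [] := wP j.
  rewrite (_ : u = -1 *: (\sum_(j < r) d j *: (w j - (k j : R) *: g ord0)) +
                   (v - c ord0 *: g ord0)).
    apply: Tsub.2; first by apply: submod_closed_sum => // j; have [] := wP j.
    rewrite vE addrAC subrr add0r.
    by apply/asboolP; exists (fun i => c (lift ord0 i)).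
  rewrite [c ord0]dE scaler_suml scaleN1r /u.
  under [in RHS]eq_bigr do rewrite scalerBr scalerA.
  by rewrite sumrB opprB [RHS]addrC addrA subrK.
exists (fun i => match split i with inl a => e a | inr b => d b end).
rewrite big_split_ord /=.
under eq_bigr => i _ do rewrite (unsplitK (inl i)).
under [X in _ + X]eq_bigr => i _ do rewrite (unsplitK (inr i)).
by rewrite -eE /u subrK.
Qed.

Fact rV_fin_gen (R : nzRingType) n : fin_gen (predT : {pred 'rV[R]_n}).
Proof.
exists n, (fun i => delta_mx 0 i); split=> // v _.
by exists (fun i => v 0 i); exact: row_sum_delta.
Qed.
HB.instance Definition _ (R : nzRingType) n :=
  isFinGen.Build R 'rV[R]_n (rV_fin_gen R n).

Section FreeCover.
Variables (R : comNzRingType) (V : lmodType R) (n : nat) (g : 'I_n -> V).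

Definition lincomb (c : 'rV[R]_n) : V := \sum_(i < n) c 0 i *: g i.
Fact lincomb_linear : linear lincomb.
Proof.
move=> a u v; rewrite /lincomb scaler_sumr -big_split /=.
by apply: eq_bigr => i _; rewrite !mxE scalerDl scalerA.
Qed.
HB.instance Definition _ :=
  GRing.isLinear.Build R 'rV[R]_n V _ lincomb lincomb_linear.
End FreeCover.

Lemma projective_rV (R : comNzRingType) (n : nat) : projective 'rV[R]_n.
Proof.
move=> X Y p f p_surj.
have [x xE] := boolp.choice (fun i => p_surj (f (delta_mx 0 i))).
exists (lincomb x) => v; rewrite [in RHS](row_sum_delta v) !linear_sum.
by apply: eq_bigr => i _; rewrite !linearZ /= xE.
Qed.

Record proj_onto (R : comNzRingType) (N : lmodType R) := ProjOnto {
  proj_onto_mod : fgModType R;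
  proj_onto_projective : projective proj_onto_mod;
  proj_onto_map : {linear proj_onto_mod -> N};
  proj_onto_surj : forall v, exists u, proj_onto_map u = v
}.

Lemma proj_onto_exists (R : comNzRingType) (N : fgModType R) :
  exists _ : proj_onto N, True.
Proof.
have [n [g [_ gN]]] := @fin_gen_predT R N.
unshelve eexists => //; apply: (@ProjOnto R N 'rV[R]_n _ (lincomb g)).
  exact: projective_rV.
by move=> v; have [c ->] := gN v isT; exists (\row_i c i);
  apply: eq_bigr => i _; rewrite mxE.
Qed.

(* Omega N is the kernel of this surjection, picked by the axiom of choice.    *)
Definition chosen_onto (R : comNzRingType) (N : fgModType R) : proj_onto N :=
  sval (cid (proj_onto_exists N)).

Section Syzygy.
Variables (R : noethLocalType) (N : fgModType R).
Let P : fgModType R := proj_onto_mod (chosen_onto N).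
Let p : {linear P -> N} := proj_onto_map (chosen_onto N).

Definition syz_pred : {pred P} := fun u => p u == 0.
Fact syz_pred_closed : submod_closed syz_pred.
Proof.
split; first by rewrite unfold_in /syz_pred raddf0.
move=> a u v; rewrite !unfold_in => /eqP pu /eqP pv.
by rewrite /syz_pred linearP pu pv scaler0 addr0.
Qed.
HB.instance Definition _ :=
  GRing.isSubmodClosed.Build R P syz_pred syz_pred_closed.

Record syz : Type := Syz { syz_val : P; _ : syz_val \in syz_pred }.
HB.instance Definition _ := [isSub for syz_val].
HB.instance Definition _ := [Choice of syz by <:].
HB.instance Definition _ := [SubChoice_isSubZmodule of syz by <:].
HB.instance Definition _ := [SubZmodule_isSubLmodule of syz by <:].

Fact syz_fin_gen : fin_gen (predT : {pred syz}).
Proof.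
have [n [g [gW gen]]] := fin_gen_sub (noetherianP R) (@fin_gen_predT R P)
  syz_pred_closed.
exists n, (fun i => Sub (g i) (gW i) : syz); split=> // v _.
have [c vE] := gen (val v) (valP v); exists c; apply: val_inj.
by rewrite vE raddf_sum.
Qed.
HB.instance Definition _ := isFinGen.Build R syz syz_fin_gen.
End Syzygy.

Section SyzygyFunctor.
Variable R : noethLocalType.

Section OnMaps.
Variables X Y : fgModType R.
Local Notation P N := (proj_onto_mod (chosen_onto N)).
Local Notation p N := (proj_onto_map (chosen_onto N)).

Definition induced_on_syz (f : {linear X -> Y}) (g : {linear syz X -> syz Y}) :
    Prop :=
  exists2 u : {linear P X -> P Y}, (forall z, p Y (u z) = f (p X z)) &
    forall z : syz X, val (g z) = u (val z).

Lemma induced_on_syz_exists f : exists g, induced_on_syz f g.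
Proof.
have [u uE] := @proj_onto_projective _ _ (chosen_onto X) _ _ (p Y) (f \o p X)
  (@proj_onto_surj _ _ (chosen_onto Y)).
have ker_u (z : syz X) : u (val z) \in @syz_pred R Y.
  have := valP z; rewrite !unfold_in /syz_pred uE /= => /eqP ->.
  by rewrite raddf0.
pose g (z : syz X) : syz Y := Sub (u (val z)) (ker_u z).
have g_lin : linear g.
  move=> a y z; apply: val_inj; rewrite /g SubK.
  transitivity (u (a *: val y + val z)) => //.
  by rewrite linearP.
exists (HB.pack_for {linear syz X -> syz Y} g
  (GRing.isLinear.Build _ _ _ _ g g_lin)).
by exists u => // z; rewrite /= SubK.
Qed.

Lemma induced_on_syz_linear a f f' g g' :
  induced_on_syz f g -> induced_on_syz f' g' ->
  induced_on_syz (a *: f + f') (a *: g + g').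
Proof.
move=> [u uE gE] [u' uE' gE']; exists (a *: u + u').
  by move=> z; rewrite /= -uE -uE' -linearP.
by move=> z; rewrite /= -gE -gE'.
Qed.

Lemma induced_on_syz_thru f g :
  induced_on_syz f g -> f \in @thru_projective R X Y ->
  g \in @thru_projective R (syz X) (syz Y).
Proof.
move=> [u uE gE] /asboolP [Q [a [b [projQ fE]]]].
have [b' b'E] := projQ _ _ (p Y) b (@proj_onto_surj _ _ (chosen_onto Y)).
have ker_h (z : P X) : u z - b' (a (p X z)) \in @syz_pred R Y.
  have e : p Y (u z - b' (a (p X z))) = p Y (u z) - p Y (b' (a (p X z))).
    exact: raddfB.
  by rewrite unfold_in /syz_pred e uE b'E fE subrr.
pose h (z : P X) : syz Y := Sub (u z - b' (a (p X z))) (ker_h z).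
have h_lin : linear h.
  move=> c y z; apply: val_inj; rewrite /h SubK.
  transitivity (c *: (u y - b' (a (p X y))) + (u z - b' (a (p X z)))) => //.
  by rewrite (linearP u) (linearP (p X)) (linearP a) (linearP b') scalerBr opprD addrACA.
apply/asboolP; exists (P X).
exists (val : syz X -> P X).
exists (HB.pack_for {linear P X -> syz Y} h
  (GRing.isLinear.Build _ _ _ _ h h_lin)).
split; first exact: proj_onto_projective.
move=> z; apply: val_inj; rewrite gE.
transitivity (u (val z) - b' (a (p X (val z)))); last by [].
have /eqP -> : p X (val z) == 0 by exact: (valP z).
by rewrite (raddf0 a) (raddf0 b') subr0.
Qed.

Definition syz_map (f : {linear X -> Y}) : {linear syz X -> syz Y} :=
  sval (cid (induced_on_syz_exists f)).

Definition omega (q : stable_hom X Y) : stable_hom (syz X) (syz Y) :=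
  to_stable (syz_map (mod_repr q)).

Lemma omegaP f g : induced_on_syz f g -> omega (to_stable f) = to_stable g.
Proof.
move=> fg; apply/mod_projP.
have := svalP (cid (induced_on_syz_exists (mod_repr (to_stable f)))).
rewrite -/(syz_map _) => fg'.
have e : mod_repr (to_stable f) - f \in @thru_projective R X Y.
  apply/(mod_projP (@thru_projective_closed R X Y)).
  exact: (mod_reprK (to_stable f)).
rewrite addrC -scaleN1r; apply: (induced_on_syz_thru _ _).
  exact: (induced_on_syz_linear (-1) fg fg').
by rewrite scaleN1r addrC.
Qed.

Lemma omega_linear : linear omega.
Proof.
move=> a q q'; rewrite -[q]mod_reprK -[q']mod_reprK.
set f := mod_repr q; set f' := mod_repr q'.
have [g fg] := induced_on_syz_exists f.
have [g' fg'] := induced_on_syz_exists f'.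
rewrite -/(to_stable f) -/(to_stable f') -linearP.
rewrite (omegaP (induced_on_syz_linear a fg fg')) (omegaP fg) (omegaP fg').
by rewrite linearP.
Qed.
HB.instance Definition _ := GRing.isLinear.Build R (stable_hom X Y)
  (stable_hom (syz X) (syz Y)) _ omega omega_linear.
End OnMaps.

Fixpoint syzn (n : nat) (N : fgModType R) : fgModType R :=
  if n is n'.+1 then syz (syzn n' N) else N.

Fixpoint omegan (n : nat) (X Y : fgModType R) :
    {linear stable_hom X Y -> stable_hom (syzn n X) (syzn n Y)} :=
  match n with
  | 0 => idfun
  | n'.+1 => @omega (syzn n' X) (syzn n' Y) \o omegan n' X Y
  end.
End SyzygyFunctor.

Definition ideal_pred (R : comNzRingType) (I : {pred R}) of idealr_closed I :
  {pred R} := I.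
HB.instance Definition _ (R : comNzRingType) (I : {pred R})
    (I_closed : idealr_closed I) :=
  isIdealr.Build R (ideal_pred I_closed) (I_closed : idealr_closed I).

Section QuotientRing.
Variables (R : comNzRingType) (I : {pred R}).
Hypothesis I_closed : idealr_closed I.
Local Notation Q := {ideal_quot (ideal_pred I_closed)}.

Definition ring_quot : Type := Q.
HB.instance Definition _ := GRing.ComNzRing.on ring_quot.

Definition ring_proj (a : R) : ring_quot := \pi_Q a.
Definition ring_repr (q : ring_quot) : R := repr (q : Q).

Lemma ring_reprK q : ring_proj (ring_repr q) = q.
Proof. exact: reprK. Qed.
Lemma ring_projP a b : ring_proj a = ring_proj b <-> a - b \in I.
Proof.
have E : (a - b \in I) = (ring_proj a == ring_proj b).
  exact: (Quotient.idealrBE (ideal_pred I_closed)).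
by rewrite E; split=> /eqP.
Qed.
Lemma ring_proj_eq0 a : (ring_proj a = 0) <-> a \in I.
Proof.
rewrite -[a in a \in I]subr0 -ring_projP.
by rewrite (_ : ring_proj 0 = 0) //; exact: (raddf0 (\pi_Q)).
Qed.

HB.instance Definition _ := GRing.isZmodMorphism.Build R ring_quot ring_proj
  (raddfB (\pi_Q)).
HB.instance Definition _ := GRing.isMonoidMorphism.Build R ring_quot ring_proj
  (rmorphism_monoidP (\pi_Q)).
End QuotientRing.

Lemma idealr_closed_submod (R : comNzRingType) (I : {pred R}) :
  idealr_closed I -> submod_closed (I : {pred R^o}).
Proof. by case=> I0 _ ID; split. Qed.

Definition residue_field (R : noethLocalType) : Type :=
  ring_quot (@max_ideal_maximal R).1.

Section ResidueField.
Variable R : noethLocalType.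
Local Notation k := (residue_field R).
Local Notation m_closed := (@max_ideal_maximal R).1.

HB.instance Definition _ := GRing.ComNzRing.on k.
Definition to_residue : {rmorphism R -> k} := ring_proj m_closed.

Lemma residue_inv_exists (q : k) :
  exists q' : k, (q != 0 -> q' * q = 1) /\ (q = 0 -> q' = 0).
Proof.
have [->|q0] := eqVneq q 0; first by exists 0.
suff [q' q'E] : exists q' : k, q' * q = 1.
  by exists q'; split=> // qE; rewrite qE eqxx in q0.
pose t := ring_repr q.
have tm : t \notin max_ideal R.
  by apply/negP => /(ring_proj_eq0 m_closed); rewrite ring_reprK => /eqP; exact/negP.
pose J : {pred R} := fun a => `[< exists r, a - r * t \in max_ideal R >].
have [m0 m1 mD] := m_closed.
have JE a : reflect (exists r, a - r * t \in max_ideal R) (a \in J).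
  exact: asboolP.
have [/JE [r rE]|J1] := boolP (1 \in J).
  exists (ring_proj m_closed r).
  rewrite -[q in _ * q](ring_reprK q) -rmorphM -(rmorph1 (ring_proj m_closed)).
  apply/ring_projP; rewrite -opprB -[- _]addr0 -mulN1r; exact: mD.
have J_closed : idealr_closed J.
  split=> //; first by apply/JE; exists 0; rewrite mul0r subr0.
  move=> a u v /JE [r rE] /JE [s sE]; apply/JE; exists (a * r + s).
  rewrite (_ : _ - _ = a * (u - r * t) + (v - s * t)); first exact: mD.
  by rewrite mulrBr mulrDl mulrA opprD addrACA.
case/negP: tm; apply: (@max_ideal_maximal R).2 J_closed _ _ _.
  by move=> a am; apply/JE; exists 0; rewrite mul0r subr0.
by apply/JE; exists 1; rewrite mul1r subrr.
Qed.

Definition residue_inv (q : k) : k := sval (cid (residue_inv_exists q)).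
Fact residue_mulV q : q != 0 -> residue_inv q * q = 1.
Proof. exact: (svalP (cid (residue_inv_exists q))).1. Qed.
Fact residue_inv0 : residue_inv 0 = 0.
Proof. exact: (svalP (cid (residue_inv_exists 0))).2. Qed.
HB.instance Definition _ :=
  GRing.ComNzRing_isField.Build k residue_mulV residue_inv0.

Definition residue_scale (a : R) (q : k) : k := to_residue a * q.
Fact residue_scaleA a b q :
  residue_scale a (residue_scale b q) = residue_scale (a * b) q.
Proof. by rewrite /residue_scale mulrA rmorphM. Qed.
Fact residue_scale1 : left_id 1 residue_scale.
Proof. by move=> q; rewrite /residue_scale rmorph1 mul1r. Qed.
Fact residue_scaleDr : right_distributive residue_scale +%R.
Proof. by move=> a p q; rewrite /residue_scale mulrDr. Qed.
Fact residue_scaleDl q : {morph residue_scale^~ q : a b / a + b}.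
Proof. by move=> a b; rewrite /residue_scale rmorphD mulrDl. Qed.
HB.instance Definition _ := GRing.Zmodule_isLmodule.Build R k
  residue_scaleA residue_scale1 residue_scaleDr residue_scaleDl.

Fact residue_fin_gen : fin_gen (predT : {pred k}).
Proof.
exists 1%N, (fun=> 1); split=> // q _; exists (fun=> ring_repr q).
rewrite big_ord1 -[LHS]mulr1; congr (_ * _); symmetry; exact: ring_reprK.
Qed.
HB.instance Definition _ := isFinGen.Build R k residue_fin_gen.
End ResidueField.

Lemma vspace_of_submod (K : fieldType) (V : vectType K) (W : {pred V}) :
  submod_closed W -> exists U : {vspace V}, U =i W.
Proof.
move=> [W0 WD].
pose A d := `[< exists2 U : {vspace V}, {subset U <= W} & \dim U = d >].
have A0 : exists d, A d.
  exists 0%N; apply/asboolP; exists 0%VS; last exact: dimv0.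
  by move=> v; rewrite memv0 => /eqP ->.
have Ale d : A d -> (d <= \dim {:V})%N.
  by move=> /asboolP [U _ <-]; rewrite dimvS ?subvf.
have [d /asboolP [U UW dU] dmax] := ex_maxnP A0 Ale.
exists U => w; apply/idP/idP => [/UW //|wW].
have UwW : {subset (U + <[w]>)%VS <= W}.
  move=> v /memv_addP [u uU [_ /vlineP [c ->] ->]].
  by rewrite addrC WD // UW.
have : (\dim (U + <[w]>) <= \dim U)%N.
  by rewrite dU; apply: dmax; apply/asboolP; exists (U + <[w]>)%VS.
move=> le_dim; have /eqP -> : U == (U + <[w]>)%VS by rewrite eqEdim addvSl.
by rewrite (subvP (addvSr _ _)) // memv_line.
Qed.

(* A copy of {linear N -> k} carrying its k-vector space structure instead of   *)
(* its R-module structure.                                                    *)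
Definition hom_residue (R : noethLocalType) (N : fgModType R) : Type :=
  {linear N -> residue_field R}.

Section HomResidue.
Variables (R : noethLocalType) (N : fgModType R).
Local Notation k := (residue_field R).
Local Notation V := (hom_residue N).
Implicit Types f g : {linear N -> k}.

HB.instance Definition _ := GRing.Zmodule.on V.

Fact homk_scale_linear (c : k) f : linear (fun x => c * f x).
Proof.
move=> a x y; rewrite linearP mulrDr; congr (_ + _).
exact: (mulrCA c (to_residue R a) (f x)).
Qed.
Definition homk_scale (c : k) (f : V) : V :=
  HB.pack_for {linear N -> k} (fun x => c * (f : {linear N -> k}) x)
    (GRing.isLinear.Build _ _ _ _ _ (homk_scale_linear c f)).
Fact homk_scaleA a b f : homk_scale a (homk_scale b f) = homk_scale (a * b) f.
Proof. by apply: linear_ext => x /=; rewrite mulrA. Qed.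
Fact homk_scale1 : left_id 1 homk_scale.
Proof. by move=> f; apply: linear_ext => x /=; rewrite mul1r. Qed.
Fact homk_scaleDr : right_distributive homk_scale +%R.
Proof. by move=> a f g; apply: linear_ext => x /=; rewrite mulrDr. Qed.
Fact homk_scaleDl f : {morph homk_scale^~ f : a b / a + b}.
Proof. by move=> a b; apply: linear_ext => x /=; rewrite mulrDl. Qed.
HB.instance Definition _ := GRing.Zmodule_isLmodule.Build k V
  homk_scaleA homk_scale1 homk_scaleDr homk_scaleDl.

Fact homk_finite_dim : exists d, exists f : V -> 'rV[k]_d,
  linear f /\ bijective f.
Proof.
have [n [g [_ gN]]] := @fin_gen_predT R N.
pose ev (f : V) : 'rV[k]_n := \row_i (f : {linear N -> k}) (g i).
have ev_lin : linear ev by move=> c f f'; apply/rowP => i; rewrite !mxE.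
have ev_inj : injective ev.
  move=> f f' /rowP e; apply: linear_ext => x.
  have [c ->] := gN x isT; rewrite !linear_sum; apply: eq_bigr => i _.
  by rewrite !linearZ; congr (_ *: _); have := e i; rewrite !mxE.
pose W : {pred 'rV[k]_n} := fun r => `[< exists f : V, ev f = r >].
have W_closed : submod_closed W.
  split; first by apply/asboolP; exists (0 : V); apply/rowP => i; rewrite !mxE.
  move=> c _ _ /asboolP [f <-] /asboolP [f' <-].
  by apply/asboolP; exists (c *: (f : V) + (f' : V)); rewrite ev_lin.
have [U UW] := vspace_of_submod W_closed.
have evU (f : V) : ev f \in U by rewrite UW; apply: asboolT; exists f.
pose e := vbasis (fullv : {vspace subvs_of U}).
have e_basis : basis_of fullv e by exact: vbasisP.
pose F (f : V) := passmx.rVof e (vsproj U (ev f)).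
exists _, F; split.
  by move=> c f f'; rewrite /F ev_lin (linearP (vsproj U)) passmx.rVof_linear.
have F_inj : injective F.
  move=> f f' /(can_inj (passmx.rVofK e_basis)) /(congr1 vsval).
  by rewrite !vsprojK // => /ev_inj.
have F_surj r : exists f, F f = r.
  have := subvsP (passmx.vecof e r).
  rewrite UW => /asboolP [f fE]; exists f.
  by rewrite /F fE vsvalK passmx.vecofK.
have [G GE] := boolp.choice F_surj; exists G => // f.
exact: F_inj.
Qed.

Fact homk_vector_axiom :
  Vector.axiom (sval (cid homk_finite_dim)) V.
Proof.
have [f [f_lin f_bij]] := cid (svalP (cid homk_finite_dim)).
by exists f.
Qed.
HB.instance Definition _ := Lmodule_hasFinDim.Build k V homk_vector_axiom.

(* The composite Hom(N, k) -> stable Hom(N, k) ->                             *)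
(*   stable Hom(Omega^n N, Omega^n k).                                        *)
Definition xi_map (n : nat) (f : hom_residue N) :
    stable_hom (syzn n N) (syzn n (k : fgModType R)) :=
  omegan n N (k : fgModType R) (to_stable (f : {linear N -> k})).

Definition xi_pred (n : nat) : {pred hom_residue N} := fun f => xi_map n f == 0.

Fact xi_pred_closed n : submod_closed (xi_pred n).
Proof.
split; first by rewrite unfold_in /xi_pred /xi_map !raddf0.
move=> c f g; rewrite !unfold_in => /eqP f0 /eqP g0.
have -> : c *: f + g = (ring_repr c *: (f : {linear N -> k}) + g) :> V.
  apply: linear_ext => x /=; congr (_ + _).
  by rewrite -[c in LHS]ring_reprK.
rewrite /xi_pred /xi_map !linearP.
move: f0 g0; rewrite /xi_map => -> ->.
by rewrite scaler0 addr0.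
Qed.

Definition xi_kernel (n : nat) : {vspace hom_residue N} :=
  sval (cid (vspace_of_submod (xi_pred_closed n))).

Lemma mem_xi_kernel n f : (f \in xi_kernel n) = (xi_map n f == 0).
Proof. exact: (svalP (cid (vspace_of_submod (xi_pred_closed n)))). Qed.
End HomResidue.

Definition xi (R : noethLocalType) (n : nat) (N : fgModType R) : nat :=
  \dim (xi_kernel N n).
Arguments xi R n N : clear implicits.

Definition nonzerodivisor_on (R : nzRingType) (x : R) (V : lmodType R) : Prop :=
  forall v : V, x *: v = 0 -> v = 0.

Section Reduction.
Variables (R : noethLocalType) (x : R).
Hypothesis xm : x \in max_ideal R.

Definition principal_ideal : {pred R} := fun a => `[< exists r, a = x * r >].
Let xRP a : reflect (exists r, a = x * r) (a \in principal_ideal).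
Proof. exact: asboolP. Qed.

Fact principal_ideal_closed : idealr_closed principal_ideal.
Proof.
have [m0 m1 mD] := (@max_ideal_maximal R).1.
split; first by apply/xRP; exists 0; rewrite mulr0.
  apply: contra m1 => /xRP [r ->].
  by rewrite mulrC -[_ * _]addr0 mD.
move=> a _ _ /xRP [r ->] /xRP [s ->].
by apply/xRP; exists (a * r + s); rewrite mulrDr mulrCA.
Qed.

Definition reduced_ring : Type := ring_quot principal_ideal_closed.
HB.instance Definition _ := GRing.ComNzRing.on reduced_ring.
Definition to_reduced : {rmorphism R -> reduced_ring} :=
  ring_proj principal_ideal_closed.

Lemma to_reducedK (q : reduced_ring) : to_reduced (ring_repr q) = q.
Proof. exact: ring_reprK. Qed.

Definition preideal (J : {pred reduced_ring}) : {pred R} :=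
  fun a => to_reduced a \in J.

Lemma preideal_closed J : idealr_closed J -> idealr_closed (preideal J).
Proof.
move=> [J0 J1 JD]; split; rewrite ?unfold_in /preideal ?rmorph0 ?rmorph1 //.
move=> a u v; rewrite !unfold_in /preideal => uJ vJ.
by rewrite rmorphD rmorphM; exact: JD.
Qed.

Definition imideal (I : {pred R}) : {pred reduced_ring} :=
  fun q => ring_repr q \in I.

Lemma mem_imideal (I : {pred R}) a : idealr_closed I -> x \in I ->
  (to_reduced a \in imideal I) = (a \in I).
Proof.
move=> [I0 I1 ID] xI.
have /ring_projP/xRP [r rE] := ring_reprK (to_reduced a).
rewrite [LHS]unfold_in /imideal.
have {rE}-> : ring_repr (to_reduced a) = x * r + a by rewrite -rE subrK.
apply/idP/idP => [h|aI]; last by rewrite mulrC ID.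
rewrite (_ : a = (- r) * x + (x * r + a)); first exact: ID.
by rewrite mulNr mulrC addrA addNr add0r.
Qed.

Lemma imideal_closed (I : {pred R}) :
  idealr_closed I -> x \in I -> idealr_closed (imideal I).
Proof.
move=> Icl xI; have [I0 I1 ID] := Icl.
split; rewrite -?(rmorph0 to_reduced) -?(rmorph1 to_reduced) ?mem_imideal //.
move=> a u v.
rewrite -[a]to_reducedK -[u]to_reducedK -[v]to_reducedK -rmorphM -rmorphD !mem_imideal //; exact: ID.
Qed.

Lemma preidealK (J : {pred reduced_ring}) : imideal (preideal J) =i J.
Proof.
by move=> q; rewrite -[in RHS](to_reducedK q).
Qed.

Fact reduced_max_ideal : maximal_ideal (imideal (max_ideal R)).
Proof.
have [mcl mmax] := @max_ideal_maximal R.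
split; first exact: imideal_closed.
move=> J Jcl mJ q qJ; rewrite unfold_in /imideal.
apply: mmax (preideal_closed Jcl) _ _ _; last first.
  by rewrite unfold_in /preideal to_reducedK.
by move=> a am; rewrite unfold_in /preideal mJ // mem_imideal.
Qed.

Fact reduced_max_ideal_unique (J : {pred reduced_ring}) :
  maximal_ideal J -> J =i imideal (max_ideal R).
Proof.
move=> [Jcl Jmax].
have xJ : x \in preideal J.
  have [J0 _ _] := Jcl; rewrite unfold_in /preideal.
  suff -> : to_reduced x = 0 by [].
  by apply/ring_proj_eq0/xRP; exists 1; rewrite mulr1.
have /max_ideal_unique E : maximal_ideal (preideal J).
  split; first exact: preideal_closed.
  move=> K Kcl JK; have xK := JK _ xJ.
  move=> a aK; rewrite unfold_in /preideal.
  apply: Jmax (imideal_closed Kcl xK) _ _ _; last by rewrite mem_imideal.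
  move=> q qJ; rewrite unfold_in /imideal JK //.
  by rewrite unfold_in /preideal to_reducedK.
by move=> q; rewrite -preidealK !unfold_in; exact: E.
Qed.

Fact reduced_noetherian : noetherian reduced_ring.
Proof.
move=> J [J0 JD].
have Jpre : submod_closed (preideal J : {pred R^o}).
  split; first by rewrite unfold_in /preideal rmorph0.
  move=> a u v; rewrite !unfold_in /preideal => uJ vJ.
  have -> : to_reduced (a *: u + v) = (to_reduced a : reduced_ring) *:
      (to_reduced u : reduced_ring^o) + to_reduced v.
    by rewrite rmorphD rmorphM.
  exact: JD.
have [n [g [gJ gen]]] := noetherianP R _ Jpre.
exists n, (fun i => to_reduced (g i)); split; first by move=> i; exact: gJ.
move=> q qJ.
have /gen [c cE] : ring_repr q \in preideal J.
  by rewrite unfold_in /preideal to_reducedK.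
exists (fun i => to_reduced (c i)).
rewrite -[LHS]to_reducedK cE rmorph_sum.
by apply: eq_bigr => i _; rewrite rmorphM.
Qed.

HB.instance Definition _ := isNoethLocal.Build reduced_ring
  reduced_max_ideal reduced_max_ideal_unique reduced_noetherian.

Variable M : fgModType R.

Definition scaled_submod : {pred M} := fun v => `[< exists w, v = x *: w >].
Let xMP v : reflect (exists w, v = x *: w) (v \in scaled_submod).
Proof. exact: asboolP. Qed.

Fact scaled_submod_closed : submod_closed scaled_submod.
Proof.
split; first by apply/xMP; exists 0; rewrite scaler0.
move=> a _ _ /xMP [v ->] /xMP [w ->]; apply/xMP; exists (a *: v + w).
by rewrite scalerDr !scalerA mulrC.
Qed.

Definition reduced_mod : Type := mod_quot scaled_submod_closed.
HB.instance Definition _ := GRing.Zmodule.on reduced_mod.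

Definition to_reduced_mod (v : M) : reduced_mod :=
  mod_proj scaled_submod_closed v.

Definition reduced_scale (a : reduced_ring) (q : reduced_mod) : reduced_mod :=
  ring_repr a *: (q : mod_quot scaled_submod_closed).

Fact reduced_scaleE (a : R) (v : M) :
  reduced_scale (to_reduced a) (to_reduced_mod v) = to_reduced_mod (a *: v).
Proof.
rewrite /reduced_scale -linearZ; apply/mod_projP; rewrite -scalerBl.
have /ring_projP/xRP [r ->] := ring_reprK (to_reduced a).
by apply/xMP; exists (r *: v); rewrite scalerA.
Qed.

Fact to_reduced_modK (q : reduced_mod) : exists v, q = to_reduced_mod v.
Proof. by exists (mod_repr q); rewrite /to_reduced_mod mod_reprK. Qed.
Fact reduced_scaleA a b q :
  reduced_scale a (reduced_scale b q) = reduced_scale (a * b) q.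
Proof.
have [v ->] := to_reduced_modK q.
rewrite -[a]to_reducedK -[b]to_reducedK -rmorphM !reduced_scaleE.
by rewrite scalerA.
Qed.
Fact reduced_scale1 : left_id 1 reduced_scale.
Proof.
move=> q; have [v ->] := to_reduced_modK q.
by rewrite -(rmorph1 to_reduced) reduced_scaleE scale1r.
Qed.
Fact reduced_scaleDr : right_distributive reduced_scale +%R.
Proof. by move=> a p q; rewrite /reduced_scale scalerDr. Qed.
Fact reduced_scaleDl q : {morph reduced_scale^~ q : a b / a + b}.
Proof.
move=> a b; have [v ->] := to_reduced_modK q.
rewrite -[a]to_reducedK -[b]to_reducedK -rmorphD !reduced_scaleE scalerDl.
exact: mod_projD.
Qed.
HB.instance Definition _ := GRing.Zmodule_isLmodule.Build reduced_ring
  reduced_mod reduced_scaleA reduced_scale1 reduced_scaleDr reduced_scaleDl.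

Fact reduced_mod_fin_gen : fin_gen (predT : {pred reduced_mod}).
Proof.
have [n [g [_ gen]]] := @fin_gen_predT R M.
exists n, (fun i => to_reduced_mod (g i)); split=> // q _.
have [v ->] := to_reduced_modK q; have [c ->] := gen v isT.
exists (fun i => to_reduced (c i)).
rewrite /to_reduced_mod linear_sum; apply: eq_bigr => i _.
by rewrite -[RHS]/(reduced_scale _ _) reduced_scaleE.
Qed.
HB.instance Definition _ :=
  isFinGen.Build reduced_ring reduced_mod reduced_mod_fin_gen.
End Reduction.

(* Main.v *)
Require Import Defs.
From mathcomp Require Import all_boot all_algebra.
From HB Require Import structures.
From mathcomp Require Import boolp.
Import GRing.Theory.
Local Open Scope ring_scope.

Set Implicit Arguments.
Unset Strict Implicit.
Unset Printing Implicit Defensive.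

(** Write S for R/xR and call a homomorphism f of finitely generated modules
n-null when its n-th syzygy factors through a projective module.  Syzygies may
be computed from any surjections from finitely generated projectives, because
the n-null maps form a two-sided ideal containing the maps through projectives
([null_ideal], [null_induced]); and xi(n, N) is the dimension of the space of
n-null maps N -> k ([null_omegan], [mem_xi_null]).

Reduction modulo x identifies Hom_R(M, k) with Hom_S(M/xM, k).  Let f : M -> k
correspond to g : M/xM -> k.

If f is n-null over R then g is n-null over S ([null_quo]).  Since x is regular
on M, reducing a short exact sequence K -> P -> M with P projective modulo x
gives an exact K/xK -> P/xP -> M/xM with P/xP projective over S, and x is again
regular on K, a submodule of P.  One can thus descend a factorization of the
n-th syzygy of f step by step.

If g is n-null over S then f is (n+1)-null over R.  For the induction,
[null_restr] replaces k by any finitely generated S-module N.  When n = 0, f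
factors through some S^m, whose R-syzygy is xR^m, isomorphic to R^m.  For the
inductive step, take L -> S^m -> N exact over S and let T be the kernel of R^m
-> S^m -> N.  The syzygy K -> T of f composed with the surjection e : T -> L is
the map corresponding to the S-syzygy K/xK -> L of g, so it is (n+1)-null by
induction. The kernel of e is xR^m, which is projective, and composing with a
surjection of projective kernel reflects (n+1)-null maps ([null_lift]): if B ->
T is a surjection from a projective with kernel B1, and C is the kernel of the
composite B -> L, then C is a syzygy of L that contains the syzygy B1 of T as a
direct summand.

The residue fields of R and S are isomorphic but distinct fields, so dimensions
are compared along semilinear injections ([dim_semilinear]). *)

(** * Linear maps and factorizations through projectives *)

Section LinearMaps.
Variable R : comNzRingType.
Implicit Types A B L P Q X Y : lmodType R.

Definition linear_of X Y (f : X -> Y) (f_lin : linear f) : {linear X -> Y} :=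
  HB.pack_for {linear X -> Y} f (GRing.isLinear.Build _ _ _ _ f f_lin).

Lemma factor_inj A B L (h : {linear A -> B}) (i : {linear L -> B}) :
  injective i -> (forall a, exists l, i l = h a) ->
  exists h' : {linear A -> L}, forall a, i (h' a) = h a.
Proof.
move=> i_inj /boolp.choice [h' h'E].
have h'_lin : linear h'.
  by move=> c a b; apply: i_inj; rewrite linearP !h'E linearP.
by exists (linear_of h'_lin).
Qed.

Lemma thru_projective_intro X Y P (f : {linear X -> Y}) (a : {linear X -> P})
    (b : {linear P -> Y}) :
  projective P -> (forall v, f v = b (a v)) -> f \in @thru_projective R X Y.
Proof. by move=> projP fE; apply/asboolP; exists P, a, b. Qed.

Lemma thru_projective_lift X Y Q (f : {linear X -> Y}) (q : {linear Q -> Y}) :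
  f \in @thru_projective R X Y -> (forall y, exists z, q z = y) ->
  exists h : {linear X -> Q}, forall v, q (h v) = f v.
Proof.
move=> /asboolP [P [a [b [projP fE]]]] q_surj.
have [b' b'E] := projP _ _ q b q_surj.
by exists (b' \o a) => v; rewrite /= b'E fE.
Qed.

Lemma thru_projective_comp X Y (X' Y' : lmodType R) (f : {linear X -> Y})
    (a : {linear X' -> X}) (b : {linear Y -> Y'}) :
  f \in @thru_projective R X Y ->
  (b \o f \o a : {linear X' -> Y'}) \in @thru_projective R X' Y'.
Proof.
move=> /asboolP [P [c [d [projP fE]]]].
by apply: (@thru_projective_intro _ _ P _ (c \o a) (b \o d)) => // v /=;
  rewrite fE.
Qed.

Lemma projective_regular (P : fgModType R) (x : R) :
  nonzerodivisor_on x R^o -> projective P -> nonzerodivisor_on x P.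
Proof.
move=> x_reg projP v xv0.
have [n [g [_ gP]]] := @fin_gen_predT R P.
have g_surj w : exists c, lincomb g c = w.
  have [c ->] := gP w isT; exists (\row_i c i).
  by apply: eq_bigr => i _; rewrite mxE.
have [s sE] := projP _ _ (lincomb g) idfun g_surj.
have sv0 : s v = 0.
  have /rowP xsv0 : x *: s v = 0 by rewrite -linearZ xv0 raddf0.
  apply/rowP => i; rewrite mxE; apply: x_reg.
  by have := xsv0 i; rewrite !mxE.
by rewrite -[v]/(idfun v) -sE sv0 raddf0.
Qed.
End LinearMaps.

(** * Kernels and syzygies *)

Section Kernel.
Variables (R : noethLocalType) (P : fgModType R) (X : lmodType R).
Variable p : {linear P -> X}.

Definition kernel_pred : {pred P} := fun u => p u == 0.
Fact kernel_pred_closed : submod_closed kernel_pred.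
Proof.
split; first by rewrite unfold_in /kernel_pred raddf0.
move=> a u v; rewrite !unfold_in => /eqP pu /eqP pv.
by rewrite /kernel_pred linearP pu pv scaler0 addr0.
Qed.
HB.instance Definition _ :=
  GRing.isSubmodClosed.Build R P kernel_pred kernel_pred_closed.

(** The kernel of [p], a finitely generated module because [R] is noetherian. *)
Record kernel : Type :=
  Kernel { kernel_val : P; _ : kernel_val \in kernel_pred }.
HB.instance Definition _ := [isSub for kernel_val].
HB.instance Definition _ := [Choice of kernel by <:].
HB.instance Definition _ := [SubChoice_isSubZmodule of kernel by <:].
HB.instance Definition _ := [SubZmodule_isSubLmodule of kernel by <:].

Fact kernel_fin_gen : fin_gen (predT : {pred kernel}).
Proof.
have [n [g [gW gen]]] := fin_gen_sub (noetherianP R) (@fin_gen_predT R P)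
  kernel_pred_closed.
exists n, (fun i => Sub (g i) (gW i) : kernel); split=> // v _.
have [c vE] := gen (val v) (valP v); exists c; apply: val_inj.
by rewrite vE raddf_sum.
Qed.
HB.instance Definition _ := isFinGen.Build R kernel kernel_fin_gen.

Lemma kernel_exact u : p u = 0 <-> exists z : kernel, val z = u.
Proof.
split=> [/eqP pu|[z <-]]; last exact/eqP/(valP z).
by exists (Sub u pu); rewrite SubK.
Qed.
End Kernel.

(** A short exact sequence [syz_mod -> syz_cover -> X] of finitely generated
modules with projective middle term, so that [syz_mod] is one of the possible
syzygies of [X]. *)
Record syzygy (R : noethLocalType) (X : fgModType R) := Syzygy {
  syz_cover : fgModType R;
  syz_cover_projective : projective syz_cover;
  syz_mod : fgModType R;
  syz_incl : {linear syz_mod -> syz_cover};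
  syz_proj : {linear syz_cover -> X};
  syz_proj_surj : forall v, exists u, syz_proj u = v;
  syz_incl_inj : injective syz_incl;
  syz_exact : forall u, syz_proj u = 0 <-> exists z, syz_incl z = u
}.

Arguments syz_cover_projective {R X} s.
Arguments syz_proj_surj {R X} s v.
Arguments syz_incl_inj {R X} s [x1 x2].
Arguments syz_exact {R X} s u.

(** * Maps whose n-th syzygy factors through a projective *)

Section NullMaps.
Variable R : noethLocalType.
Implicit Types X Y Z : fgModType R.

(** The syzygy given by a surjection from a projective module. *)
Definition kernel_syzygy (P X : fgModType R) (p : {linear P -> X})
    (projP : projective P) (p_surj : forall v, exists u, p u = v) : syzygy X :=
  @Syzygy R X P projP (kernel p) (val : kernel p -> P) p p_surj val_inj
    (kernel_exact p).

Lemma chosen_exact X (u : proj_onto_mod (chosen_onto X)) :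
  proj_onto_map (chosen_onto X) u = 0 <-> exists z : syz X, val z = u.
Proof.
split=> [/eqP pu|[z <-]]; last exact/eqP/(valP z).
by exists (Sub u pu); rewrite SubK.
Qed.

(** The syzygy that [syz] and [omega] are built from. *)
Definition chosen_syzygy X : syzygy X :=
  @Syzygy R X _ (@proj_onto_projective _ _ (chosen_onto X)) (syz X)
    (val : syz X -> proj_onto_mod (chosen_onto X)) _
    (@proj_onto_surj _ _ (chosen_onto X)) val_inj (@chosen_exact X).

Lemma syz_complex X (s : syzygy X) z : syz_proj s (syz_incl s z) = 0.
Proof. by apply/(syz_exact _); exists z. Qed.

(** [g] is the map induced on syzygies by some lift of [f] to the projective
modules; it depends on the lift. *)
Definition induced X Y (s : syzygy X) (t : syzygy Y) (f : {linear X -> Y})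
    (g : {linear syz_mod s -> syz_mod t}) : Prop :=
  exists2 u : {linear syz_cover s -> syz_cover t},
    (forall w, syz_proj t (u w) = f (syz_proj s w)) &
    forall z, syz_incl t (g z) = u (syz_incl s z).

Lemma induced_exists X Y (s : syzygy X) (t : syzygy Y) (f : {linear X -> Y}) :
  exists g, induced (s := s) (t := t) f g.
Proof.
have [u uE] := syz_cover_projective s _ _ (syz_proj t) (f \o syz_proj s)
  (syz_proj_surj t).
have [|g gE] := @factor_inj _ _ _ _ (u \o syz_incl s) (syz_incl t)
  (syz_incl_inj t).
  by move=> z; apply/(syz_exact _); rewrite /= uE /= syz_complex raddf0.
by exists g; exists u.
Qed.

Lemma induced_comp X Y Z (s : syzygy X) (t : syzygy Y) (r : syzygy Z)
    (f : {linear X -> Y}) (f' : {linear Y -> Z})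
    (g : {linear syz_mod s -> syz_mod t})
    (g' : {linear syz_mod t -> syz_mod r}) :
  induced f g -> induced f' g' -> induced (f' \o f) (g' \o g).
Proof.
move=> [u uE gE] [u' uE' gE']; exists (u' \o u) => z /=.
  by rewrite uE' uE.
by rewrite gE' gE.
Qed.

Lemma induced_linear X Y (s : syzygy X) (t : syzygy Y) (a : R)
    (f f' : {linear X -> Y}) (g g' : {linear syz_mod s -> syz_mod t}) :
  induced f g -> induced f' g' -> induced (a *: f + f') (a *: g + g').
Proof.
move=> [u uE gE] [u' uE' gE']; exists (a *: u + u') => z.
  by rewrite /= -uE -uE' -linearP.
transitivity (a *: syz_incl t (g z) + syz_incl t (g' z)); first exact: linearP.
by rewrite gE gE'.
Qed.

Lemma induced_thru X Y (s : syzygy X) (t : syzygy Y)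
    (f : {linear X -> Y}) (g : {linear syz_mod s -> syz_mod t}) :
  induced f g -> f \in @thru_projective R X Y ->
  g \in @thru_projective R (syz_mod s) (syz_mod t).
Proof.
move=> [u uE gE] f_thru.
have [h hE] := thru_projective_lift f_thru (syz_proj_surj t).
have [|d dE] := @factor_inj _ _ _ _ (u \- (h \o syz_proj s)) (syz_incl t)
  (syz_incl_inj t).
  move=> w; apply/(syz_exact _).
  transitivity (syz_proj t (u w) - syz_proj t (h (syz_proj s w))).
    exact: raddfB.
  by rewrite uE hE subrr.
apply: (thru_projective_intro (a := syz_incl s) (b := d)).
  exact: syz_cover_projective.
move=> z; apply: (syz_incl_inj t); rewrite gE dE /=.
transitivity (u (syz_incl s z) - h (syz_proj s (syz_incl s z))) => //.
by rewrite syz_complex raddf0 subr0.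
Qed.

(** [null n f]: the n-th syzygy of [f] factors through a projective module.  The
choices of syzygies and lifts are existentially quantified; [null_induced] shows
that they do not matter. *)
Fixpoint null (n : nat) X Y (f : {linear X -> Y}) : Prop :=
  if n is n'.+1 then
    exists (s : syzygy X) (t : syzygy Y) (g : {linear syz_mod s -> syz_mod t}),
      induced f g /\ null n' g
  else f \in @thru_projective R X Y.

(** The [n]-null maps form a two-sided ideal containing the maps that factor
through projectives. *)
Definition null_ideal_at (n : nat) : Prop :=
  [/\ forall X Y (f : {linear X -> Y}),
        f \in @thru_projective R X Y -> null n f,
      forall X Y (f f' : {linear X -> Y}),
        null n f -> null n f' -> null n (f + f') &
      forall (X Y X' Y' : fgModType R) (f : {linear X -> Y})
        (a : {linear X' -> X}) (b : {linear Y -> Y'}),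
        null n f -> null n (b \o f \o a)].

(** Two choices of syzygies are related by maps induced by the identity; up to
these, two maps induced by [f] differ by a map induced by 0. *)
Lemma null_induced_at n X Y (f : {linear X -> Y}) (s : syzygy X) (t : syzygy Y)
    (g : {linear syz_mod s -> syz_mod t}) :
  null_ideal_at n -> null n.+1 f -> induced f g -> null n g.
Proof.
move=> [n_thru n_add n_comp] [s0 [t0 [g0 [fg0 g0_null]]]] fg.
have [a aE] := induced_exists s s0 idfun.
have [b bE] := induced_exists t0 t idfun.
have fg' := induced_comp (induced_comp aE fg0) bE.
pose h : {linear syz_mod s -> syz_mod t} := b \o g0 \o a.
have -> : g = h + (-1 *: h + g) by rewrite scaleN1r addrA subrr add0r.
apply: n_add; first exact: n_comp.
apply: n_thru; apply: (induced_thru (induced_linear (-1) fg' fg)).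
rewrite (_ : _ + _ = 0); first exact: (thru_projective_closed _ _).1.
by apply: linear_ext => v /=; rewrite scaleN1r addNr.
Qed.

Lemma null_ideal n : null_ideal_at n.
Proof.
elim: n => [|n IHn].
  split=> [//|X Y f f' f0 f'0|X Y X' Y' f a b f0].
    rewrite /= -[f]scale1r; exact: (thru_projective_closed _ _).2.
  exact: thru_projective_comp.
have [n_thru n_add n_comp] := IHn.
split=> [X Y f f_thru|X Y f f' f0 f'0|X Y X' Y' f a b f0].
- have [g fg] := induced_exists (chosen_syzygy X) (chosen_syzygy Y) f.
  exists (chosen_syzygy X), (chosen_syzygy Y), g; split=> //.
  exact/n_thru/(induced_thru fg).
- have [g fg] := induced_exists (chosen_syzygy X) (chosen_syzygy Y) f.
  have [g' fg'] := induced_exists (chosen_syzygy X) (chosen_syzygy Y) f'.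
  exists (chosen_syzygy X), (chosen_syzygy Y), (g + g'); split.
    by rewrite -[f]scale1r -[g]scale1r; exact: induced_linear.
  by apply: n_add; [apply: (null_induced_at IHn f0)
                   | apply: (null_induced_at IHn f'0)].
- have [g fg] := induced_exists (chosen_syzygy X) (chosen_syzygy Y) f.
  have [a' aE] := induced_exists (chosen_syzygy X') (chosen_syzygy X) a.
  have [b' bE] := induced_exists (chosen_syzygy Y) (chosen_syzygy Y') b.
  exists (chosen_syzygy X'), (chosen_syzygy Y'), (b' \o g \o a'); split.
    exact: (induced_comp aE (induced_comp fg bE)).
  by apply: n_comp; apply: (null_induced_at IHn f0).
Qed.

Lemma null_comp n (X Y X' Y' : fgModType R) (f : {linear X -> Y})
    (a : {linear X' -> X}) (b : {linear Y -> Y'}) :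
  null n f -> null n (b \o f \o a).
Proof. by have [_ _] := null_ideal n; exact. Qed.

Lemma null_induced n X Y (f : {linear X -> Y}) (s : syzygy X) (t : syzygy Y)
    (g : {linear syz_mod s -> syz_mod t}) :
  induced f g -> null n.+1 f <-> null n g.
Proof.
move=> fg; split=> [f0|g0]; last by exists s, t, g.
exact: null_induced_at (null_ideal n) f0 fg.
Qed.

(** [omegan n.+1] takes the n-th syzygy and then one more, whereas [null n.+1]
takes one syzygy and then n more; hence the generalization over [m]. *)
Lemma null_omegan n X Y (f : {linear X -> Y}) :
  null n f <-> omegan n X Y (to_stable f) = 0.
Proof.
suff [g [gE gnull]] : exists g : {linear syzn n X -> syzn n Y},
    omegan n X Y (to_stable f) = to_stable g /\
    forall m, null (n + m) f <-> null m g.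
  rewrite gE -{1}[n]addn0 gnull.
  have := mod_projP (thru_projective_closed (syzn n X) (syzn n Y)) g 0.
  by rewrite subr0 /= mod_proj0 => ->.
elim: n => [|n [g [gE gnull]]]; first by exists f.
have [h gh] := induced_on_syz_exists g.
exists h; split; first by rewrite /= gE; exact: omegaP.
move=> m; rewrite addSnnS gnull.
exact: (@null_induced _ _ _ _ (chosen_syzygy _) (chosen_syzygy _)).
Qed.

(** Let [E -> T -> L] be exact, [B -> T] a surjection from a projective with
kernel [B1], and [C] the kernel of the composite [B -> L].  The quotient
[C / B1] is isomorphic to the projective module [E], so the inclusion of [B1] in
[C] has a retraction. *)
Lemma null_lift n X (T L : fgModType R) (E : lmodType R) (i : {linear E -> T})
    (e : {linear T -> L}) (g : {linear X -> T}) :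
  projective E -> injective i -> (forall l, exists w, e w = l) ->
  (forall w, e w = 0 <-> exists z, i z = w) ->
  null n.+1 (e \o g) -> null n.+1 g.
Proof.
move=> projE i_inj e_surj ex eg0.
move: (chosen_syzygy X) (chosen_syzygy T) => s t.
have et_surj l : exists w, (e \o syz_proj t) w = l.
  have [w <-] := e_surj l; have [b <-] := syz_proj_surj t w.
  by exists b.
(* [syz_mod r] is C and [syz_mod t] is B1. *)
pose r := kernel_syzygy (syz_cover_projective t) et_surj.
have [w [u uE wE]] := induced_exists s t g.
have [|j jE] := factor_inj (h := syz_incl t) (syz_incl_inj r).
  by move=> z; apply/(syz_exact r); rewrite /= syz_complex raddf0.
have eg_jw : induced (s := s) (t := r) (e \o g) (j \o w).
  exists u => z; first by rewrite /= -uE.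
  by rewrite -wE -jE.
have jw0 := (null_induced n eg_jw).1 eg0.
have [|d dE] := factor_inj (h := syz_proj t \o syz_incl r) i_inj.
  move=> c; apply/ex; exact: (syz_complex c).
have d_surj y : exists c, d c = y.
  have [b bE] := syz_proj_surj t (i y).
  have /(syz_exact r) [c cE] : syz_proj r b = 0.
    by rewrite /= bE; apply/ex; exists y.
  by exists c; apply: i_inj; rewrite dE -bE -cE.
have [v vE] := projE _ _ d idfun d_surj.
(* [v] splits [d : C -> E], so [q] is the retraction c |-> c - v (d c). *)
have [|q qE] := factor_inj (h := syz_incl r \o (idfun \- (v \o d)))
    (syz_incl_inj t).
  move=> c; apply/(syz_exact _); rewrite -[LHS]dE.
  have -> : d ((idfun \- (v \o d)) c) = d c - d (v (d c)) by exact: raddfB.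
  by rewrite vE subrr raddf0.
apply/(null_induced n (g := w)); first by exists u.
have -> : w = q \o (j \o w) \o idfun.
  apply: linear_ext => z; apply: (syz_incl_inj t) => /=.
  have dj0 : d (j (w z)) = 0.
    apply: i_inj.
    by rewrite dE /= -[val _]/(syz_incl r _) jE syz_complex raddf0.
  rewrite qE; transitivity (syz_incl r (j (w z) - v (d (j (w z))))) => //.
  by rewrite dj0 raddf0 subr0 jE.
exact: null_comp.
Qed.
End NullMaps.

(** * Reduction modulo x and restriction of scalars *)

(** [S] is a copy of the local ring [R/xR].  The arguments below use only these
properties of the projection, not the construction of the quotient. *)
Record ring_reduction (R : noethLocalType) (x : R) (S : noethLocalType) :=
    RingReduction {
  quo_map : {rmorphism R -> S};
  quo_map_surj : forall a, exists b, quo_map b = a;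
  quo_map_eq0 : forall a, quo_map a = 0 <-> exists b, a = x * b;
  quo_map_max : forall a, (quo_map a \in max_ideal S) = (a \in max_ideal R)
}.

Section Restriction.
Variables (R S : noethLocalType) (x : R) (pi : ring_reduction x S).
Local Notation quo_map := (quo_map pi).

(** An [S]-module seen as an [R]-module, by restriction of scalars. *)
Definition restr_type (N : lmodType S) : Type := N.

Section Module.
Variable N : lmodType S.
HB.instance Definition _ := GRing.Zmodule.on (restr_type N).

Definition restr_scale (a : R) (v : restr_type N) : restr_type N :=
  quo_map a *: (v : N).
Fact restr_scaleA a b v :
  restr_scale a (restr_scale b v) = restr_scale (a * b) v.
Proof. by rewrite /restr_scale scalerA rmorphM. Qed.
Fact restr_scale1 : left_id 1 restr_scale.
Proof. by move=> v; rewrite /restr_scale rmorph1 scale1r. Qed.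
Fact restr_scaleDr : right_distributive restr_scale +%R.
Proof. by move=> a u v; rewrite /restr_scale scalerDr. Qed.
Fact restr_scaleDl v : {morph restr_scale^~ v : a b / a + b}.
Proof. by move=> a b; rewrite /restr_scale rmorphD scalerDl. Qed.
HB.instance Definition _ := GRing.Zmodule_isLmodule.Build R (restr_type N)
  restr_scaleA restr_scale1 restr_scaleDr restr_scaleDl.
End Module.

Fact restr_fin_gen (N : fgModType S) : fin_gen (predT : {pred restr_type N}).
Proof.
have [n [g [_ gen]]] := @fin_gen_predT S N.
exists n, g; split=> // v _; have [c ->] := gen v isT.
have [d dE] := boolp.choice (fun i => quo_map_surj pi (c i)).
by exists d; apply: eq_bigr => i _; rewrite -dE.
Qed.
HB.instance Definition _ (N : fgModType S) :=
  isFinGen.Build R (restr_type N) (restr_fin_gen N).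

(** Restriction of scalars for arbitrary modules, and for finitely generated
ones; the two agree as modules. *)
Definition restr_lmod (N : lmodType S) : lmodType R := restr_type N.
Definition restr (N : fgModType S) : fgModType R := restr_type N.

Definition restr_map (N N' : lmodType S) (f : {linear N -> N'}) :
  {linear restr_lmod N -> restr_lmod N'} :=
  @linear_of R (restr_lmod N) (restr_lmod N') f
    (fun a u v => linearP f (quo_map a) u v).

Lemma restr_torsion (N : lmodType S) (v : restr_lmod N) : x *: v = 0.
Proof.
have x0 : quo_map x = 0 by apply/quo_map_eq0; exists 1; rewrite mulr1.
by rewrite -[LHS]/(quo_map x *: (v : N)) x0 scale0r.
Qed.

(** [quo] is a copy of the [S]-module [X/xX], with its projection from [X]. *)
Record module_reduction (X : fgModType R) := ModuleReduction {
  quo : fgModType S;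
  reduction : {linear X -> restr quo};
  reduction_surj : forall q : restr quo, exists v, reduction v = q;
  reduction_eq0 : forall v, reduction v = 0 <-> exists w, v = x *: w
}.
End Restriction.
Arguments reduction_surj {R S x pi X} m q.
Arguments reduction_eq0 {R S x pi X} m v.

Section BaseChange.
Variables (R S : noethLocalType) (x : R) (pi : ring_reduction x S).
Variable red : forall X : fgModType R, module_reduction pi X.
Local Notation quo_map := (quo_map pi).
Local Notation restr := (restr pi).
Local Notation restr_lmod := (restr_lmod pi).
Local Notation quo X := (quo (red X)).
Local Notation reduction X := (reduction (red X)).

Lemma descend (X : fgModType R) (N : lmodType S)
    (h : {linear X -> restr_lmod N}) :
  exists h' : {linear quo X -> N}, forall v, h' (reduction X v) = h v.
Proof.
have kill v w : reduction X v = reduction X w -> h v = h w.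
  move=> e; have /(reduction_eq0 _) [z zE] : reduction X (v - w) = 0.
    by rewrite linearB e subrr.
  apply/eqP; rewrite -subr_eq0 -linearB zE linearZ; apply/eqP.
  exact: restr_torsion.
have [r rE] := boolp.choice (reduction_surj (red X)).
pose h' (q : quo X) : N := h (r q).
have h'E v : h' (reduction X v) = h v by apply: kill; rewrite rE.
have h'_lin : linear h'.
  move=> a p q.
  have [v <-] := reduction_surj _ p; have [w <-] := reduction_surj _ q.
  have [b <-] := quo_map_surj pi a.
  transitivity (h' (reduction X (b *: v + w))); first by rewrite linearP.
  by rewrite !h'E linearP.
by exists (linear_of h'_lin) => v; exact: h'E.
Qed.

Lemma quo_projective (P : fgModType R) : projective P -> projective (quo P).
Proof.
move=> projP X Y p f p_surj.
have [h hE] := projP _ _ (restr_map pi p) (restr_map pi f \o reduction P)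
  p_surj.
have [g gE] := descend h; exists g => q.
have [v <-] := reduction_surj _ q.
by rewrite gE; exact: hE.
Qed.

Lemma syz_mod_regular (X : fgModType R) (s : syzygy X) :
  nonzerodivisor_on x R^o -> nonzerodivisor_on x (syz_mod s).
Proof.
move=> x_reg z xz0; apply: (syz_incl_inj s); rewrite raddf0.
apply: (projective_regular x_reg (syz_cover_projective s)).
by rewrite -linearZ xz0 raddf0.
Qed.

(** The reductions modulo x of the two maps of a syzygy. *)
Definition quo_incl (X : fgModType R) (s : syzygy X) :
    {linear quo (syz_mod s) -> quo (syz_cover s)} :=
  sval (cid (descend (reduction _ \o syz_incl s))).
Definition quo_proj (X : fgModType R) (s : syzygy X) :
    {linear quo (syz_cover s) -> quo X} :=
  sval (cid (descend (reduction _ \o syz_proj s))).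

Lemma quo_inclE (X : fgModType R) (s : syzygy X) z :
  quo_incl s (reduction _ z) = reduction _ (syz_incl s z).
Proof. exact: (svalP (cid (descend (reduction _ \o syz_incl s)))). Qed.
Lemma quo_projE (X : fgModType R) (s : syzygy X) w :
  quo_proj s (reduction _ w) = reduction _ (syz_proj s w).
Proof. exact: (svalP (cid (descend (reduction _ \o syz_proj s)))). Qed.

Lemma quo_proj_surj (X : fgModType R) (s : syzygy X) q :
  exists p, quo_proj s p = q.
Proof.
have [v <-] := reduction_surj _ q; have [w <-] := syz_proj_surj s v.
by exists (reduction _ w); rewrite quo_projE.
Qed.

Lemma quo_incl_inj (X : fgModType R) (s : syzygy X) :
  nonzerodivisor_on x X -> injective (quo_incl s).
Proof.
move=> x_reg q q' e; apply/eqP; rewrite -subr_eq0; apply/eqP.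
have : quo_incl s (q - q') = 0 by rewrite linearB e subrr.
have [z <-] := reduction_surj _ (q - q').
rewrite quo_inclE => /(reduction_eq0 _) [w wE].
have /(syz_exact s) [z' z'E] : syz_proj s w = 0.
  by apply: x_reg; rewrite -linearZ -wE syz_complex.
apply/(reduction_eq0 _); exists z'; apply: (syz_incl_inj s).
by rewrite wE linearZ z'E.
Qed.

Lemma quo_exact (X : fgModType R) (s : syzygy X) q :
  quo_proj s q = 0 <-> exists z, quo_incl s z = q.
Proof.
have [w <-] := reduction_surj _ q; split=> [|[q']].
  rewrite quo_projE => /(reduction_eq0 _) [v].
  have [w' <-] := syz_proj_surj s v => e.
  have /(syz_exact s) [z zE] : syz_proj s (w - x *: w') = 0.
    by rewrite linearB linearZ e subrr.
  exists (reduction _ z); rewrite quo_inclE zE linearB.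
  have -> : reduction _ (x *: w') = 0 by apply/(reduction_eq0 _); exists w'.
  by rewrite subr0.
have [z <-] := reduction_surj _ q'; rewrite quo_inclE => <-.
by rewrite quo_projE syz_complex linear0.
Qed.

Definition quo_syzygy (X : fgModType R) (x_reg : nonzerodivisor_on x X)
    (s : syzygy X) : syzygy (quo X) :=
  Syzygy (quo_projective (syz_cover_projective s)) (@quo_proj_surj X s)
    (quo_incl_inj x_reg) (@quo_exact X s).

(** * Comparison of null maps over R and over R/xR *)

Lemma null_quo n (X Y : fgModType R) (Y' : fgModType S) (f : {linear X -> Y})
    (b : {linear Y -> restr Y'}) (f' : {linear quo X -> Y'}) :
  nonzerodivisor_on x R^o -> nonzerodivisor_on x X ->
  (forall v, f' (reduction X v) = b (f v)) -> null n f -> null n f'.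
Proof.
move=> x_regR; elim: n => [|n IHn] in X Y Y' f b f' *.
  move=> _ f'E f_null.
  pose t := chosen_syzygy Y'.
  have bf_thru := thru_projective_comp idfun b f_null.
  have [h hE] := thru_projective_lift (q := restr_map pi (syz_proj t))
    bf_thru (syz_proj_surj t).
  have [h' h'E] := descend h.
  apply: (thru_projective_intro (a := h') (b := syz_proj t)).
    exact: syz_cover_projective.
  move=> q; have [v <-] := reduction_surj _ q.
  by rewrite f'E h'E; apply/esym; exact: hE.
move=> x_reg f'E [s [t [g [[u uE gE] g_null]]]].
pose t' := chosen_syzygy Y'.
(* [b1] lifts [b] to the projective modules; [b2] is its restriction to the
   syzygies. *)
have [b1 b1E] := syz_cover_projective t _ _ (restr_map pi (syz_proj t'))
  (b \o syz_proj t) (syz_proj_surj t').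
have [|b2 b2E] := factor_inj (h := b1 \o syz_incl t)
    (i := restr_map pi (syz_incl t')) (syz_incl_inj t').
  move=> z; apply/(syz_exact t').
  by apply: (etrans (b1E _)); rewrite /= syz_complex linear0.
have [u' u'E] := descend (b1 \o u).
have [g' g'E] := descend (b2 \o g).
apply/(null_induced (s := quo_syzygy x_reg s) (t := t') n (g := g'));
  last first.
  exact: IHn (@syz_mod_regular _ s x_regR) g'E g_null.
exists u' => q; have [v <-] := reduction_surj _ q.
  rewrite [syz_proj (quo_syzygy _ _) _]quo_projE f'E -uE u'E; exact: b1E.
rewrite [syz_incl (quo_syzygy _ _) _]quo_inclE g'E u'E /= -gE; exact: b2E.
Qed.

Definition scale_map (V : lmodType R) (a : R) : {linear V -> V} := a \*: idfun.

Lemma map_row_linear m :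
  linear (map_mx quo_map : 'rV[R]_m -> restr 'rV[S]_m).
Proof.
move=> a u v; apply/rowP => i.
by rewrite -[RHS]/((quo_map a *: map_mx quo_map u + map_mx quo_map v) 0 i)
  !mxE rmorphD rmorphM.
Qed.
(** The projection R^m -> S^m. *)
Definition map_row m : {linear 'rV[R]_m -> restr 'rV[S]_m} :=
  linear_of (@map_row_linear m).

Lemma map_row_surj m v : exists u, map_row m u = v.
Proof.
have [r rE] := boolp.choice (fun i => quo_map_surj pi ((v : 'rV[S]_m) 0 i)).
exists (\row_i r i); apply/rowP => i.
by rewrite !mxE.
Qed.

Lemma map_row_eq0 m u : map_row m u = 0 <-> exists w, x *: w = u.
Proof.
split=> [/rowP u0|[w <-]].
  have /boolp.choice [r rE] : forall i, exists b, u 0 i = x * b.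
    by move=> i; apply/(quo_map_eq0 pi); have := u0 i; rewrite !mxE.
  by exists (\row_i r i); apply/rowP => i; rewrite !mxE.
apply/rowP => i; rewrite !mxE; apply/(quo_map_eq0 pi).
by exists (w 0 i).
Qed.

Lemma scale_row_inj m : nonzerodivisor_on x R^o ->
  injective (scale_map 'rV[R]_m x).
Proof.
move=> x_reg u v /= /eqP; rewrite -subr_eq0 -scalerBr => /eqP /rowP e.
apply/eqP; rewrite -subr_eq0; apply/eqP/rowP => i; rewrite [RHS]mxE.
by apply: x_reg; have := e i; rewrite !mxE.
Qed.

(** R^m, embedded by multiplication by x, is an R-syzygy of S^m. *)
Definition row_syzygy m (x_reg : nonzerodivisor_on x R^o) :
    syzygy (restr 'rV[S]_m) :=
  Syzygy (@projective_rV R m) (@map_row_surj m) (scale_row_inj x_reg)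
    (@map_row_eq0 m).

(** One more syzygy is taken over [R] than over [S] because nonzero free
[S]-modules have projective dimension 1 over [R]. *)
Lemma null_restr n (X : fgModType R) (N : fgModType S)
    (f : {linear X -> restr N}) (f' : {linear quo X -> N}) :
  nonzerodivisor_on x R^o -> nonzerodivisor_on x X ->
  (forall v, f' (reduction X v) = f v) -> null n f' -> null n.+1 f.
Proof.
move=> x_regR.
have cover (N0 : fgModType S) : exists m (q : {linear 'rV[S]_m -> N0}),
    forall v, exists c, q c = v.
  have [m [g [_ gN]]] := @fin_gen_predT S N0.
  exists m, (lincomb g) => v; have [c ->] := gN v isT.
  by exists (\row_i c i); apply: eq_bigr => i _; rewrite mxE.
elim: n => [|n IHn] in X N f f' *; have [m [q q_surj]] := cover N.
  move=> _ f'E f'_thru; have [h hE] := thru_projective_lift f'_thru q_surj.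
  have -> : f = restr_map pi q \o idfun \o (restr_map pi h \o reduction X).
    by apply: linear_ext => v; rewrite -f'E -hE.
  (* The identity of S^m is 1-null, since the syzygy R^m is projective. *)
  apply: (null_comp (Y := restr 'rV[S]_m)).
  exists (row_syzygy m x_regR), (row_syzygy m x_regR), idfun; split.
    by exists idfun.
  by apply: (thru_projective_intro (a := idfun) (b := idfun)) => //;
    exact: projective_rV.
move=> x_reg f'E f'_null.
pose s := chosen_syzygy X.
pose t' := kernel_syzygy (@projective_rV S m) q_surj.
have [g' fg'] := induced_exists (quo_syzygy x_reg s) t' f'.
have g'_null := (null_induced n fg').1 f'_null; have [u' u'E g'E] := fg'.
(* The composite K -> K/xK -> L is (n+1)-null by induction. *)
have {}g'_null : null n.+1 (restr_map pi g' \o reduction (syz_mod s) :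
    {linear syz_mod s -> restr (syz_mod t')}).
  have := IHn _ _ (restr_map pi g' \o reduction (syz_mod s)) g'.
  by apply=> //; exact: syz_mod_regular.
have qr_surj v : exists w, (restr_map pi q \o map_row m) w = v.
  by have [c <-] := q_surj v; have [w <-] := map_row_surj c; exists w.
(* [syz_mod t] is T, the kernel of R^m -> S^m -> N. *)
pose t := kernel_syzygy (P := 'rV[R]_m) (X := restr N) (@projective_rV R m)
  qr_surj.
have [u uE] := syz_cover_projective s _ _ (map_row m)
  (restr_map pi u' \o reduction (syz_cover s)) (@map_row_surj m).
have u_lift w : syz_proj t (u w) = f (syz_proj s w).
  rewrite -f'E -quo_projE -[RHS]u'E; exact: (congr1 q (uE w)).
have [|g gE] := factor_inj (h := u \o syz_incl s) (i := syz_incl t)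
    (syz_incl_inj t).
  by move=> z; apply/(syz_exact t); rewrite [LHS]u_lift syz_complex linear0.
(* [e] is the surjection T -> L, and [i] identifies its kernel with R^m. *)
have [|e eE] := factor_inj (h := map_row m \o syz_incl t)
    (i := restr_map pi (syz_incl t')) (syz_incl_inj t').
  by move=> z; apply/(syz_exact t'); exact: (syz_complex (s := t) z).
have [|i iE] := factor_inj (h := scale_map 'rV[R]_m x) (i := syz_incl t)
    (syz_incl_inj t).
  move=> w; apply/(syz_exact t).
  have -> : syz_proj t (scale_map _ x w) = q (map_row m (x *: w)) by [].
  have -> : map_row m (x *: w) = 0 by apply/map_row_eq0; exists w.
  exact: linear0.
apply/(null_induced (s := s) (t := t) n.+1 (g := g)); first by exists u.
apply: (null_lift (i := i) (e := e)).
- exact: projective_rV.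
- move=> v w /(congr1 (syz_incl t)); rewrite !iE; exact: scale_row_inj.
- move=> l; have [w wE] := map_row_surj (syz_incl t' l).
  have /(syz_exact t) [z zE] : syz_proj t w = 0.
    by apply: (etrans (congr1 q wE)); exact: (syz_complex (s := t') l).
  exists z; apply: (syz_incl_inj t'); apply: (etrans (eE z)).
  exact: etrans (congr1 (map_row m) zE) wE.
- move=> z; split=> [ez0|[w wE]].
    have /map_row_eq0 [w wE] : map_row m (syz_incl t z) = 0.
      by apply: (etrans (esym (eE z))); rewrite ez0; exact: linear0.
    by exists w; apply: (syz_incl_inj t); rewrite iE.
  apply: (syz_incl_inj t'); apply: (etrans (eE z)).
  rewrite [RHS]linear0 -wE; apply/map_row_eq0.
  by exists w; rewrite iE.
suff /linear_ext -> : (e \o g : {linear syz_mod s -> restr (syz_mod t')}) =1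
    (restr_map pi g' \o reduction (syz_mod s) : {linear _ -> restr _}).
  exact: g'_null.
move=> z; apply: (syz_incl_inj t'); apply: (etrans (eE (g z))).
apply: (etrans (congr1 (map_row m) (gE z))); apply: (etrans (uE _)).
transitivity (u' (quo_incl s (reduction _ z))); first by rewrite quo_inclE.
exact: esym (g'E _).
Qed.
End BaseChange.

(** * Comparison of dimensions *)

(** An additive injection that is semilinear along a surjective morphism of
fields [K -> K'] cannot decrease dimensions.  Only a preimage [d] of each scalar [c] is
used; the morphism itself is not part of the data. *)
Lemma dim_semilinear (K K' : fieldType) (V : vectType K) (V' : vectType K')
    (U : {vspace V}) (U' : {vspace V'}) (F : V -> V') :
  zmod_morphism F -> (forall v, F v = 0 -> v = 0) ->
  (forall c, exists2 d, d = 0 -> c = 0 & forall v, F (d *: v) = c *: F v) ->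
  (forall v, v \in U -> F v \in U') -> (\dim U <= \dim U')%N.
Proof.
move=> F_add F_inj F_scale FU.
have F0 : F 0 = 0 by rewrite -[X in F X](subrr 0) F_add subrr.
have FD u v : F (u + v) = F u + F v.
  by rewrite -[v in LHS]opprK -[- v]sub0r !F_add F0 sub0r opprK.
have Fsum n (w : 'I_n -> V) : F (\sum_(i < n) w i) = \sum_(i < n) F (w i).
  exact: (big_morph F FD F0).
pose X := vbasis U; pose Y := [tuple of map F X].
have freeY : free Y.
  apply/freeP => c Y0 i.
  have /boolp.choice [d dE] : forall j, exists d, (d = 0 -> c j = 0) /\
      forall v, F (d *: v) = c j *: F v.
    by move=> j; have [d d0 dE] := F_scale (c j); exists d.
  apply: (dE i).1.
  have /freeP freeX := basis_free (vbasisP U).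
  apply: (freeX d) => //; apply: F_inj.
  rewrite Fsum -[RHS]Y0; apply: eq_bigr => j _.
  by rewrite (dE j).2 (nth_map 0) // size_tuple.
have /dimvS : (<<Y>> <= U')%VS.
  apply/span_subvP => _ /mapP [v vX ->]; apply: FU.
  exact: vbasis_mem vX.
by rewrite (eqP freeY) size_tuple.
Qed.

Section Residue.
Variables (R S : noethLocalType) (x : R) (pi : ring_reduction x S).
Variable red : forall X : fgModType R, module_reduction pi X.
Local Notation quo_map := (quo_map pi).
Local Notation restr := (restr pi).
Local Notation quo X := (quo (red X)).
Local Notation reduction X := (reduction (red X)).

(** The residue field as a finitely generated module. *)
Definition residue_mod (T : noethLocalType) : fgModType T := residue_field T.

Lemma residue_eq a b :
  to_residue S (quo_map a) = to_residue S (quo_map b) <->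
  to_residue R a = to_residue R b.
Proof.
apply: (iff_trans (ring_projP (@max_ideal_maximal S).1 _ _)).
rewrite -rmorphB quo_map_max.
exact: iff_sym (ring_projP (@max_ideal_maximal R).1 _ _).
Qed.

(** The isomorphism between the residue fields of [R] and [S]. *)
Definition residue_map (q : residue_field R) : residue_field S :=
  to_residue S (quo_map (ring_repr q)).

Lemma residue_mapE a : residue_map (to_residue R a) = to_residue S (quo_map a).
Proof. by apply/residue_eq; exact: ring_reprK. Qed.

Lemma residue_mapP q : exists a, q = to_residue R a.
Proof. by exists (ring_repr q); rewrite /to_residue /= ring_reprK. Qed.

Lemma residue_map_surj c : exists q, residue_map q = c.
Proof.
have [a aE] := quo_map_surj pi (ring_repr c).
exists (to_residue R a); rewrite residue_mapE aE; exact: ring_reprK.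
Qed.

Lemma residue_map_inj : injective residue_map.
Proof.
move=> p q; have [a ->] := residue_mapP p; have [b ->] := residue_mapP q.
by rewrite !residue_mapE => /residue_eq.
Qed.

Lemma residue_mapD : {morph residue_map : p q / p + q}.
Proof.
move=> p q; have [a ->] := residue_mapP p; have [b ->] := residue_mapP q.
by rewrite -rmorphD !residue_mapE !rmorphD.
Qed.
Lemma residue_mapM : {morph residue_map : p q / p * q}.
Proof.
move=> p q; have [a ->] := residue_mapP p; have [b ->] := residue_mapP q.
by rewrite -rmorphM !residue_mapE !rmorphM.
Qed.
Lemma residue_map0 : residue_map 0 = 0.
Proof. by rewrite -(rmorph0 (to_residue R)) residue_mapE !rmorph0. Qed.

Fact residue_map_linear :
  linear (residue_map : residue_mod R -> restr (residue_mod S)).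
Proof.
move=> a p q; transitivity (residue_map (to_residue R a * p + q)); first by [].
by rewrite residue_mapD residue_mapM residue_mapE.
Qed.
(** The same isomorphism as an [R]-linear map. *)
Definition residue_iso : {linear residue_mod R -> restr (residue_mod S)} :=
  linear_of residue_map_linear.

Lemma residue_iso_inv :
  exists g : {linear restr (residue_mod S) -> residue_mod R},
  forall c, residue_iso (g c) = c.
Proof.
have [g gE] := factor_inj (h := idfun) (i := residue_iso) residue_map_inj
  residue_map_surj.
by exists g.
Qed.

(** The linear map underlying an element of the vector space [hom_residue N]. *)
Definition hom_fun (T : noethLocalType) (N : fgModType T) (f : hom_residue N) :
  {linear N -> residue_mod T} := f.

Lemma mem_xi_null (T : noethLocalType) (N : fgModType T) n (f : hom_residue N) :
  f \in xi_kernel N n <-> null n (hom_fun f).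
Proof.
rewrite mem_xi_kernel; split=> [/eqP e|/(null_omegan n (hom_fun f)) e].
  exact/(null_omegan n (hom_fun f)).
exact/eqP.
Qed.

Lemma hom_funB (T : noethLocalType) (N : fgModType T) (f g : hom_residue N) v :
  hom_fun (f - g) v = hom_fun f v - hom_fun g v.
Proof. by []. Qed.
Lemma hom_funZ (T : noethLocalType) (N : fgModType T) c (f : hom_residue N) v :
  hom_fun (c *: f) v = (c : residue_field T) * hom_fun f v.
Proof. by []. Qed.

Section HomQuo.
Variable M : fgModType R.

(** [g] is obtained from [f] by reduction modulo x. *)
Definition corresponds (f : hom_residue M) (g : hom_residue (quo M)) : Prop :=
  forall v, hom_fun g (reduction M v) = residue_map (hom_fun f v).

Lemma hom_quo_exists f : exists g, corresponds f g.
Proof. exact: (descend red (residue_iso \o hom_fun f)). Qed.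

Lemma hom_lift_exists g : exists f, corresponds f g.
Proof.
have [h hE] := factor_inj (h := restr_map pi (hom_fun g) \o reduction M)
  (i := residue_iso) residue_map_inj (fun v => residue_map_surj _).
by exists h => v; apply/esym; exact: hE.
Qed.

Lemma corresponds_null f g n :
  nonzerodivisor_on x R^o -> nonzerodivisor_on x M ->
  corresponds f g -> null n (hom_fun f) -> null n (hom_fun g).
Proof. by move=> x_regR x_regM fg; exact: (null_quo (b := residue_iso)). Qed.

Lemma corresponds_null_succ f g n :
  nonzerodivisor_on x R^o -> nonzerodivisor_on x M ->
  corresponds f g -> null n (hom_fun g) -> null n.+1 (hom_fun f).
Proof.
move=> x_regR x_regM fg g_null; have [k kE] := residue_iso_inv.
have := null_restr (f := restr_map pi (hom_fun g) \o reduction M)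
  x_regR x_regM (fun=> erefl) g_null.
move=> /(null_comp idfun k) h_null.
suff /linear_ext -> : (hom_fun f : {linear M -> residue_mod R}) =1
   (k \o (restr_map pi (hom_fun g) \o reduction M) \o idfun :
     {linear M -> residue_mod R}) by exact: h_null.
move=> v; apply: residue_map_inj; rewrite -fg; apply/esym; exact: kE.
Qed.

Lemma corresponds_injl f f' g : corresponds f g -> corresponds f' g -> f = f'.
Proof.
move=> fg f'g; apply: linear_ext => v; apply: residue_map_inj.
by apply: (etrans (esym (fg v))); exact: f'g.
Qed.

Lemma corresponds_injr f g g' : corresponds f g -> corresponds f g' -> g = g'.
Proof.
move=> fg fg'; apply: linear_ext => q.
have [v <-] := reduction_surj (red M) q.
by apply: (etrans (fg v)); apply/esym; exact: fg'.
Qed.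

Lemma corresponds0 : corresponds 0 0.
Proof. by move=> v; apply/esym; exact: residue_map0. Qed.

Lemma correspondsB f f' g g' : corresponds f g -> corresponds f' g' ->
  corresponds (f - f') (g - g').
Proof.
move=> fg f'g' v; rewrite !hom_funB fg f'g'.
apply: (canLR (addrK _)); rewrite -[RHS]residue_mapD.
by rewrite subrK.
Qed.

Lemma correspondsZ f g c : corresponds f g ->
  corresponds (c *: f) (residue_map c *: g).
Proof. by move=> fg v; rewrite !hom_funZ fg -residue_mapM. Qed.

Lemma xi_le_quo n : nonzerodivisor_on x R^o -> nonzerodivisor_on x M ->
  (xi R n M <= xi S n (quo M))%N.
Proof.
move=> x_regR x_regM; have [F FE] := boolp.choice hom_quo_exists.
apply: (@dim_semilinear (residue_field R) (residue_field S) (hom_residue M)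
  (hom_residue (quo M)) _ _ F).
- move=> f f'; apply: corresponds_injr (FE _) _; exact: correspondsB.
- move=> f Ff0; apply: corresponds_injl (FE f) _.
  by rewrite Ff0; exact: corresponds0.
- move=> c; have [d <-] := residue_map_surj c; exists d => [->|f].
    exact: residue_map0.
  by apply: corresponds_injr (FE _) _; exact: correspondsZ.
- move=> f /mem_xi_null f0; apply/mem_xi_null.
  exact: corresponds_null (FE f) f0.
Qed.

Lemma xi_quo_le n : nonzerodivisor_on x R^o -> nonzerodivisor_on x M ->
  (xi S n (quo M) <= xi R n.+1 M)%N.
Proof.
move=> x_regR x_regM; have [F FE] := boolp.choice hom_lift_exists.
apply: (@dim_semilinear (residue_field S) (residue_field R)
  (hom_residue (quo M)) (hom_residue M) _ _ F).
- move=> g g'; apply: corresponds_injl (FE _) _; exact: correspondsB.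
- move=> g Fg0; apply: corresponds_injr (FE g) _.
  by rewrite Fg0; exact: corresponds0.
- move=> d; exists (residue_map d) => [d0|g].
    by apply: residue_map_inj; rewrite d0 residue_map0.
  by apply: corresponds_injl (FE _) _; exact: correspondsZ.
- move=> g /mem_xi_null g0; apply/mem_xi_null.
  exact: corresponds_null_succ (FE g) g0.
Qed.
End HomQuo.
End Residue.

(** * The quotient ring and modules *)

Section Concrete.
Variables (R : noethLocalType) (x : R) (x_max : x \in max_ideal R).
Local Notation S := (reduced_ring x_max).

Lemma to_reduced_surj a : exists b, to_reduced x_max b = a.
Proof. by exists (ring_repr a); exact: to_reducedK. Qed.

Lemma to_reduced_eq0 a : to_reduced x_max a = 0 <-> exists b, a = x * b.
Proof.
apply: (iff_trans (ring_proj_eq0 (principal_ideal_closed x_max) a)).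
by split=> [/asboolP|b] //; exact/asboolP.
Qed.

Lemma to_reduced_max a :
  (to_reduced x_max a \in max_ideal S) = (a \in max_ideal R).
Proof. exact: (mem_imideal x_max a (@max_ideal_maximal R).1 x_max). Qed.

Definition reduced_ring_reduction : ring_reduction x S :=
  RingReduction to_reduced_surj to_reduced_eq0 to_reduced_max.

Section Module.
Variable X : fgModType R.
Definition reduced_fgmod : fgModType S := reduced_mod x X.

Fact to_reduced_mod_linear :
  linear (@to_reduced_mod R x X :
    X -> restr reduced_ring_reduction reduced_fgmod).
Proof.
move=> a u v.
rewrite -[RHS]/(reduced_scale (to_reduced x_max a) (to_reduced_mod x u)
                + to_reduced_mod x v).
by rewrite reduced_scaleE; exact: mod_projD.
Qed.

Lemma to_reduced_mod_eq0 (v : X) :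
  to_reduced_mod x v = 0 <-> exists w, v = x *: w.
Proof.
have E := mod_projP (scaled_submod_closed x X) v 0.
rewrite subr0 mod_proj0 in E.
by apply: (iff_trans E); split=> [/asboolP//|w]; exact/asboolP.
Qed.

Lemma to_reduced_mod_surj (q : reduced_mod x X) :
  exists v, to_reduced_mod x v = q.
Proof. by have [v ->] := to_reduced_modK q; exists v. Qed.

Definition reduced_mod_reduction : module_reduction reduced_ring_reduction X :=
  @ModuleReduction _ _ _ reduced_ring_reduction X reduced_fgmod
    (linear_of to_reduced_mod_linear) to_reduced_mod_surj to_reduced_mod_eq0.
End Module.
End Concrete.

Theorem proposition4p20 (R : noethLocalType) (M : fgModType R) (n : nat)
    (n_gt0 : (0 < n)%N) (x : R) (x_max : x \in max_ideal R)
    (x_regR : nonzerodivisor_on x R^o) (x_regM : nonzerodivisor_on x M) :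
  (xi (reduced_ring x_max) n.-1 (reduced_mod x M) <= xi R n M)%N /\
  (xi R n M <= xi (reduced_ring x_max) n (reduced_mod x M))%N.
Proof.
split; last exact: (xi_le_quo (reduced_mod_reduction x_max)).
rewrite -[n in xi R n M](prednK n_gt0).
exact: (xi_quo_le (reduced_mod_reduction x_max)).
Qed.
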